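(* Let $\lambda>0$ and let $p\in L^1(\mathbb{R})$ be such that $\widehat p\in L^1(\mathbb{R})$ and $\|\widehat p\|_1<\lambda^2/18$. Then there exists a function $\psi\in L^1(\mathbb{R})$ such that $\sigma(x)=\frac1{2\pi}\int_{\mathbb{R}}e^{ix\xi}\psi(\xi)\,d\xi$ is a continuous function vanishing at infinity, $\widehat\sigma=\psi$ in the sense of tempered distributions, and $\sigma$ solves the band-limited integral equation $$\sigma(x)=S[T_b\sigma](x)+p(x)$$ (for almost every $x$, and for every $x$ if $p$ is continuous).
   Context: Fourier transform convention: $\widehat f(\xi)=\int f(x)e^{-ix\xi}dx$, inverse $\frac1{2\pi}\int\widehat f(\xi)e^{ix\xi}d\xi$. Fix an infinitely differentiable $b:\mathbb{R}\to[0,1]$ with $b(\xi)=1$ for $|\xi|\le\lambda$ and $b(\xi)=0$ for $|\xi|\ge\sqrt2\lambda$. For $f$ with integrable Fourier transform, $T_bf(x)=\frac1{2\pi}\int_{\mathbb{R}}e^{ix\xi}\widehat f(\xi)\frac{b(\xi)}{4\lambda^2-\xi^2}d\xi$ (a smooth function). For $f\in C^1(\mathbb{R})$, $S[f](x)=\frac14(f'(x))^2-4\lambda^2\left(e^{f(x)}-1-f(x)\right)$. *)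

(* Defs.v *)
From HB Require Import structures.
From mathcomp Require Import all_boot all_order all_algebra.
From mathcomp Require Import all_classical all_reals all_analysis.
From mathcomp Require Import complex.
Set Implicit Arguments. Unset Strict Implicit. Unset Printing Implicit Defensive.
Import Order.TTheory GRing.Theory Num.Theory.
Import numFieldNormedType.Exports.
Local Open Scope classical_set_scope.
Local Open Scope ring_scope.
Local Open Scope complex_scope.

Section Defs.
Variable R : realType.
Local Notation C := R[i].
Local Notation mu := (@lebesgue_measure R).

Definition reF (f : R -> C) : R -> R := fun x => complex.Re (f x).
Definition imF (f : R -> C) : R -> R := fun x => complex.Im (f x).

Definition eix (t : R) : C := cos t +i* sin t.
Definition cexp (z : C) : C := (expR (complex.Re z))%:C * eix (complex.Im z).

Definition cintegrable (f : R -> C) : Prop :=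
  mu.-integrable setT (fun x => (reF f x)%:E) /\
  mu.-integrable setT (fun x => (imF f x)%:E).

Definition cint (f : R -> C) : C :=
  Rintegral mu setT (reF f) +i* Rintegral mu setT (imF f).

Definition cabs (z : C) : R := Num.sqrt (complex.Re z ^+ 2 + complex.Im z ^+ 2).

Definition L1norm (f : R -> C) : R := Rintegral mu setT (fun x => cabs (f x)).

Definition fourier (f : R -> C) (xi : R) : C := cint (fun x => f x * eix (- (x * xi))).
Definition ifourier (g : R -> C) (x : R) : C :=
  ((2 * pi)^-1)%:C * cint (fun xi => eix (x * xi) * g xi).

Definition smooth (f : R -> R) : Prop := forall (n : nat) (x : R), derivable (derive1n n f) x 1.

Definition ccontinuous (f : R -> C) : Prop := continuous (reF f) /\ continuous (imF f).

Definition cderive1 (f : R -> C) (x : R) : C :=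
  derive1 (reF f) x +i* derive1 (imF f) x.

Definition schwartzR (u : R -> R) : Prop :=
  smooth u /\ forall k n : nat, exists M : R, forall x : R, `|x ^+ k * derive1n n u x| <= M.
Definition schwartz (phi : R -> C) : Prop := schwartzR (reF phi) /\ schwartzR (imF phi).

Definition tempered_fourier_eq (sigma psi : R -> C) : Prop :=
  forall phi : R -> C, schwartz phi ->
    cint (fun x => sigma x * fourier phi x) = cint (fun xi => psi xi * phi xi).

(* T_b f, written in terms of fhat = \hat f:
   (1/2pi) \int e^{i x xi} fhat(xi) b(xi)/(4 lam^2 - xi^2) dxi *)
Definition Tb (lam : R) (b : R -> R) (fhat : R -> C) (x : R) : C :=
  ifourier (fun xi => fhat xi * (b xi / (4 * lam ^+ 2 - xi ^+ 2))%:C) x.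

Definition Sop (lam : R) (f : R -> C) (x : R) : C :=
  (4^-1)%:C * (cderive1 f x) ^+ 2 - (4 * lam ^+ 2)%:C * (cexp (f x) - 1 - f x).

End Defs.

(* Main.v *)
(** The inverse Fourier transforms of integrable functions form a Banach algebra (the Wiener
    algebra): products correspond to convolutions.  Written for the Fourier transform psi of
    sigma, the equation becomes psi = Phi(psi) + p^, where Phi is built from the multiplier
    b(xi)/(4 lam^2 - xi^2), bounded by 1/(2 lam^2), from squares, and from the entire function
    e^z - 1 - z.  Phi is at least quadratic, hence a contraction with constant 1/2 on the ball
    containing the iterates started at p^, and summing the increments of the iteration gives psi.
    Fourier inversion, which turns p^ back into p, is Abel summation: the damping e^(-|xi|/m)
    produces the Poisson kernel, whose antiderivative is an arctangent, so one obtains equality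
    of the integrals over every interval. *)

Require Import Defs.
From HB Require Import structures.
From mathcomp Require Import all_boot all_order all_algebra.
From mathcomp Require Import all_classical all_reals all_analysis.
From mathcomp Require Import measurable_realfun complex.
From mathcomp Require Import ring lra.
Import Order.TTheory GRing.Theory Num.Theory.
Import numFieldNormedType.Exports.
Local Open Scope classical_set_scope.
Local Open Scope ring_scope.
Local Open Scope complex_scope.

Set Implicit Arguments.
Unset Strict Implicit.

(** * Real and complex integration *)

Section RealIntegration.
Context {R : realType}.
Local Notation mu := (@lebesgue_measure R).
Local Notation intg f := (mu.-integrable setT (EFin \o f)).
Local Notation I f := (Rintegral mu setT f).
Implicit Types f g m : R -> R.

(** Scaling fixes the shape of the constants. Multiplication by b(xi)/(4 lam^2 - xi^2) brings a
    factor of at most 1/(2 lam^2), and a derivative after it leaves a factor of at most 1/lam, since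
    xi is of order lam on the support of b. With f the transform of psi after this multiplication,
    (f')^2/4 and 4 lam^2 (e^f - 1 - f) are therefore both of size |psi|^2/lam^2, so smallness has to
    be measured in units of lam^2. In the norm [wnorm] the hypothesis puts p^ into the ball of
    radius lam^2/36. Increments that halve add up to at most twice that, lam^2/18; there f has norm
    at most 1/36, and the Lipschitz constant comes out as 23/72, rounded up to 1/2.

    Phi is not formed as an operator on psi. Products and exponentials only provide some integrable
    function with a prescribed inverse transform and a controlled norm; the equation itself is
    carried along pointwise in x, and it survives the limit because the norm dominates the supremum
    of the inverse transform. *)

Lemma intg_meas f : intg f -> measurable_fun setT f.
Proof. by move=> /integrableP[/measurable_EFinP]. Qed.

Lemma intg_le f g : measurable_fun setT f -> (forall x, `|f x| <= g x) ->
  intg g -> intg f.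
Proof.
move=> mf fg ig; apply: (le_integrable _ _ _ ig) => //; first exact/measurable_EFinP.
by move=> x _ /=; rewrite lee_fin (le_trans (fg x)) ?ler_norm.
Qed.

Lemma intgD f g : intg f -> intg g -> intg (fun x => f x + g x).
Proof. by move=> fi gi; have := integrableD measurableT fi gi. Qed.

Lemma intgB f g : intg f -> intg g -> intg (fun x => f x - g x).
Proof. by move=> fi gi; have := integrableB measurableT fi gi. Qed.

Lemma intgZ (k : R) f : intg f -> intg (fun x => k * f x).
Proof. by move=> fi; have := integrableZl measurableT k fi. Qed.

Lemma intgN f : intg f -> intg (fun x => - f x).
Proof. by move=> fi; have := integrableN fi. Qed.

Lemma intg_norm f : intg f -> intg (fun x => `|f x|).
Proof. by move=> fi; have := integrable_norm fi. Qed.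

Lemma intg0 : intg (fun=> 0 : R).
Proof. exact: integrable0. Qed.

Lemma intgM f m (M : R) : intg f -> measurable_fun setT m ->
  (forall x, `|m x| <= M) -> intg (fun x => f x * m x).
Proof.
move=> fi mm mM; apply: (@intg_le _ (fun x => M * `|f x|)).
- by apply: measurable_funM => //; exact: intg_meas.
- by move=> x; rewrite normrM mulrC ler_wpM2r.
- exact/intgZ/intg_norm.
Qed.

Lemma cont_meas f : continuous f -> measurable_fun setT f.
Proof. exact: continuous_measurable_fun. Qed.

Lemma ID f g : intg f -> intg g -> I (fun x => f x + g x) = I f + I g.
Proof. exact: RintegralD. Qed.

Lemma IB f g : intg f -> intg g -> I (fun x => f x - g x) = I f - I g.
Proof. exact: RintegralB. Qed.

Lemma IZ (k : R) f : intg f -> I (fun x => k * f x) = k * I f.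
Proof. exact: RintegralZl. Qed.

Lemma IN f : intg f -> I (fun x => - f x) = - I f.
Proof.
move=> fi; rewrite -mulN1r -IZ//; apply: eq_Rintegral => x _.
by rewrite mulN1r.
Qed.

Lemma I_ext f g : (forall x, f x = g x) -> I f = I g.
Proof. by move=> fg; apply: eq_Rintegral => x _; exact: fg. Qed.

Lemma I_le f g : intg f -> intg g -> (forall x, f x <= g x) -> I f <= I g.
Proof. by move=> fi gi fg; apply: le_Rintegral. Qed.

Lemma I_ge0 f : (forall x, 0 <= f x) -> 0 <= I f.
Proof. by move=> f0; apply: Rintegral_ge0. Qed.

Lemma I_norm f : intg f -> `|I f| <= I (fun x => `|f x|).
Proof. by move=> fi; apply: le_normr_Rintegral. Qed.

Lemma I_norm_le f g : intg f -> intg g -> (forall x, `|f x| <= g x) ->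
  `|I f| <= I g.
Proof.
move=> fi gi fg; apply: le_trans (I_norm fi) _.
by apply: I_le => //; exact: intg_norm.
Qed.

Lemma I_fin f : intg f -> (I f)%:E = (\int[mu]_x (f x)%:E)%E.
Proof. by move=> fi; rewrite /Rintegral fineK//; exact: integrable_fin_num. Qed.

Lemma I_ae f g : measurable_fun setT f -> measurable_fun setT g ->
  {ae mu, forall x, f x = g x} -> I f = I g.
Proof.
move=> mf mg fg; congr fine; apply: ae_eq_integral => //; try exact/measurable_EFinP.
by apply: filterS fg; [exact: (ae_filter_ringOfSetsType mu)|move=> x /= -> _].
Qed.

Lemma intg_ge0P f : measurable_fun setT f -> (forall x, 0 <= f x) ->
  (\int[mu]_x (f x)%:E < +oo)%E -> intg f.
Proof.
move=> mf f0 foo; apply/integrableP; split; first exact/measurable_EFinP.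
by under eq_integral do rewrite gee0_abs ?lee_fin ?f0//.
Qed.

Lemma I_dct (f_ : nat -> R -> R) f g :
  (forall n, measurable_fun setT (f_ n)) -> measurable_fun setT f ->
  {ae mu, forall x, f_ n x @[n --> \oo] --> f x} ->
  intg g -> (forall n x, `|f_ n x| <= g x) ->
  intg f /\ I (f_ n) @[n --> \oo] --> I f.
Proof.
move=> mf_ mf ff ig fg.
have fE : {ae mu, forall x, setT x -> (f_ n x)%:E @[n --> \oo] --> (f x)%:E}.
  apply: filterS ff; first exact: (ae_filter_ringOfSetsType mu).
  by move=> x h _; apply/fine_cvgP; split => //; exact: nearW.
have [||||| fi _ cv] := @dominated_convergence _ _ _ mu setT measurableT
  (fun n x => (f_ n x)%:E) (EFin \o f) (EFin \o g).
- by move=> n; apply/measurable_EFinP; exact: (mf_ n).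
- exact/measurable_EFinP.
- exact: fE.
- exact: ig.
- by apply: aeW => x n _; rewrite lee_fin.
split => //.
have /= := cv; rewrite -(I_fin fi) => /fine_cvg; exact.
Qed.

End RealIntegration.

Section ComplexIntegration.
Context {R : realType}.
Local Notation C := R[i].
Local Notation mu := (@lebesgue_measure R).
Local Notation intg f := (mu.-integrable setT (EFin \o f)).
Local Notation I f := (Rintegral mu setT f).
Implicit Types (f g h : R -> C) (z w : C).

(* The l1 modulus is submultiplicative and splits into real and imaginary parts, so it
   replaces [cabs] in all estimates; the margin in the constant 1/18 absorbs the factor 2. *)
Definition abs1 z : R := `|complex.Re z| + `|complex.Im z|.
Definition norm1 f : R := I (fun x => abs1 (f x)).
Definition cmeas (f : R -> C) : Prop :=
  measurable_fun setT (reF f) /\ measurable_fun setT (imF f).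

Lemma abs1_ge0 z : 0 <= abs1 z. Proof. by rewrite addr_ge0. Qed.

Lemma abs1_Re z : `|complex.Re z| <= abs1 z. Proof. by rewrite lerDl. Qed.

Lemma abs1_Im z : `|complex.Im z| <= abs1 z. Proof. by rewrite lerDr. Qed.

Lemma abs1D z w : abs1 (z + w) <= abs1 z + abs1 w.
Proof.
case: z w => [a b] [c d]; rewrite /abs1 /=.
have := ler_normD a c; have := ler_normD b d; lra.
Qed.

Lemma abs1M z w : abs1 (z * w) <= abs1 z * abs1 w.
Proof.
case: z w => [a b] [c d]; rewrite /abs1 /=.
have := ler_normB (a * c) (b * d); have := ler_normD (a * d) (b * c).
rewrite !normrM; nra.
Qed.

Lemma abs1N z : abs1 (- z) = abs1 z.
Proof. by case: z => [a b]; rewrite /abs1 /= !normrN. Qed.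

Lemma abs1_real (a : R) : abs1 a%:C = `|a|.
Proof. by rewrite /abs1 /= normr0 addr0. Qed.

(** The hypothesis is an inequality because identities are proved below by bounding [abs1] of a
    difference by a sequence that tends to 0. *)
Lemma abs1_eq0 z : abs1 z <= 0 -> z = 0.
Proof.
case: z => [a b]; rewrite /abs1 /= => h; apply/eqP; rewrite eq_complex /=.
by rewrite -!normr_le0; have := normr_ge0 a; have := normr_ge0 b => *; apply/andP; split; lra.
Qed.

Lemma reFM f g : reF (fun x => f x * g x) =
  (fun x => reF f x * reF g x - imF f x * imF g x).
Proof. by apply/funext => x; rewrite /reF /imF; case: (f x) (g x) => ? ? []. Qed.

Lemma imFM f g : imF (fun x => f x * g x) =
  (fun x => reF f x * imF g x + imF f x * reF g x).
Proof. by apply/funext => x; rewrite /reF /imF; case: (f x) (g x) => ? ? []. Qed.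

Lemma reFD f g : reF (fun x => f x + g x) = (fun x => reF f x + reF g x).
Proof. by apply/funext => x; rewrite /reF; case: (f x) (g x) => ? ? []. Qed.

Lemma imFD f g : imF (fun x => f x + g x) = (fun x => imF f x + imF g x).
Proof. by apply/funext => x; rewrite /imF; case: (f x) (g x) => ? ? []. Qed.

Lemma cig_meas f : cintegrable f -> cmeas f.
Proof. by move=> [fr fi]; split; exact: intg_meas. Qed.

Lemma cmeasM f g : cmeas f -> cmeas g -> cmeas (fun x => f x * g x).
Proof.
move=> [fr fi] [gr gi]; split; rewrite ?reFM ?imFM.
  by apply: measurable_funB; apply: measurable_funM.
by apply: measurable_funD; apply: measurable_funM.
Qed.

Lemma cmeas_cst z : cmeas (fun=> z).
Proof. by split; exact: measurable_cst. Qed.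

Lemma meas_abs1 f : cmeas f -> measurable_fun setT (fun x => abs1 (f x)).
Proof.
move=> [fr fi]; apply: measurable_funD.
- exact: (measurableT_comp (@normr_measurable R setT) fr).
- exact: (measurableT_comp (@normr_measurable R setT) fi).
Qed.

Lemma cig_abs1 f : cintegrable f -> intg (fun x => abs1 (f x)).
Proof. by move=> [fr fi]; apply: intgD; exact: intg_norm. Qed.

Lemma cig_le f (g : R -> R) : cmeas f -> (forall x, abs1 (f x) <= g x) ->
  intg g -> cintegrable f.
Proof.
move=> [fr fi] fg ig; split; apply: (intg_le _ _ ig) => // x.
  exact: le_trans (abs1_Re _) (fg x).
exact: le_trans (abs1_Im _) (fg x).
Qed.

Lemma cigD f g : cintegrable f -> cintegrable g -> cintegrable (fun x => f x + g x).
Proof.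
by move=> [fr fi] [gr gi]; split; rewrite -/(reF _ _) -/(imF _ _) ?reFD ?imFD; exact: intgD.
Qed.

Lemma cig0 : cintegrable (fun=> 0 : C).
Proof. by split; exact: intg0. Qed.

Lemma cigMb f m (M : R) : cintegrable f -> cmeas m -> (forall x, abs1 (m x) <= M) ->
  cintegrable (fun x => f x * m x).
Proof.
move=> fi mm mM; apply: (@cig_le _ (fun x => M * abs1 (f x))).
- exact: cmeasM (cig_meas fi) mm.
- by move=> x; rewrite (le_trans (abs1M _ _))// mulrC ler_wpM2r ?abs1_ge0.
- exact/intgZ/cig_abs1.
Qed.

Lemma cigZ z f : cintegrable f -> cintegrable (fun x => z * f x).
Proof.
move=> fi; have := cigMb fi (cmeas_cst z) (fun=> lexx _).
by congr cintegrable; apply/funext => x; rewrite mulrC.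
Qed.

Lemma cint_ext f g : (forall x, f x = g x) -> cint f = cint g.
Proof. by move=> /funext ->. Qed.

Lemma cintD f g : cintegrable f -> cintegrable g ->
  cint (fun x => f x + g x) = cint f + cint g.
Proof.
by move=> [fr fi] [gr gi]; rewrite /cint reFD imFD !ID.
Qed.

Lemma cintZ z f : cintegrable f -> cint (fun x => z * f x) = z * cint f.
Proof.
move=> [fr fi]; rewrite /cint (reFM (fun=> z)) (imFM (fun=> z)) /reF /imF.
case: z => a b /=; rewrite IB ?ID ?IZ//; exact: intgZ.
Qed.

Lemma norm1_ge0 f : 0 <= norm1 f.
Proof. by apply: I_ge0 => x; exact: abs1_ge0. Qed.

Lemma abs1_cint f : cintegrable f -> abs1 (cint f) <= norm1 f.
Proof.
move=> [fr fi]; rewrite /norm1 ID; try exact: intg_norm.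
by apply: lerD; exact: I_norm.
Qed.

Lemma norm1_le f (g : R -> R) : cintegrable f -> intg g ->
  (forall x, abs1 (f x) <= g x) -> norm1 f <= I g.
Proof. by move=> fi gi fg; apply: I_le => //; exact: cig_abs1. Qed.

Lemma norm1D f g : cintegrable f -> cintegrable g ->
  norm1 (fun x => f x + g x) <= norm1 f + norm1 g.
Proof.
move=> fi gi; rewrite /norm1 -ID; try exact: cig_abs1.
apply: I_le => [||x]; last exact: abs1D.
  exact/cig_abs1/cigD.
by apply: intgD; exact: cig_abs1.
Qed.

Lemma norm1Mb f m (M : R) : cintegrable f -> cmeas m -> (forall x, abs1 (m x) <= M) ->
  norm1 (fun x => f x * m x) <= M * norm1 f.
Proof.
move=> fi mm mM; rewrite /norm1 -IZ; last exact: cig_abs1.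
apply: norm1_le; [exact: cigMb mM|exact/intgZ/cig_abs1|].
by move=> x; rewrite (le_trans (abs1M _ _))// mulrC ler_wpM2r ?abs1_ge0.
Qed.

Lemma cabs_le_abs1 z : cabs z <= abs1 z.
Proof.
rewrite /abs1 /cabs; case: z => x y /=.
rewrite -(ger0_norm (addr_ge0 (normr_ge0 x) (normr_ge0 y))) -sqrtr_sqr ler_wsqrtr//.
rewrite sqrrD !real_normK ?num_real//.
have := mulr_ge0 (normr_ge0 x) (normr_ge0 y); lra.
Qed.

Lemma norm1_cabs f : cintegrable f -> norm1 f <= 2 * L1norm f.
Proof.
move=> fi; have [mr mi] := cig_meas fi.
have cab x : abs1 (f x) <= 2 * cabs (f x).
  rewrite /abs1 /cabs; case: (f x) => a b /=.
  have h1 : `|a| <= Num.sqrt (a ^+ 2 + b ^+ 2).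
    by rewrite -sqrtr_sqr ler_wsqrtr// lerDl sqr_ge0.
  have h2 : `|b| <= Num.sqrt (a ^+ 2 + b ^+ 2).
    by rewrite -sqrtr_sqr ler_wsqrtr// lerDr sqr_ge0.
  lra.
have mc : measurable_fun setT (fun x => cabs (f x)).
  apply: (measurableT_comp (cont_meas (@sqrt_continuous R))).
  by apply: measurable_funD; apply: measurable_funX.
have ci : intg (fun x => cabs (f x)).
  apply: (intg_le mc _ (cig_abs1 fi)) => x.
  rewrite ger0_norm ?sqrtr_ge0//; exact: cabs_le_abs1.
by rewrite /L1norm -IZ//; apply: norm1_le => //; exact: intgZ.
Qed.

Lemma cint_ae f g : cmeas f -> cmeas g -> {ae mu, forall x, f x = g x} ->
  cint f = cint g.
Proof.
move=> [fr fi] [gr gi] fg; congr (_ +i* _); apply: I_ae => //.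
  by apply: filterS fg; [exact: (ae_filter_ringOfSetsType mu)|rewrite /reF => x ->].
by apply: filterS fg; [exact: (ae_filter_ringOfSetsType mu)|rewrite /imF => x ->].
Qed.

End ComplexIntegration.

(** * Fubini, translations and convolution *)

Section FubiniConvolution.
Context {R : realType}.
Local Notation C := R[i].
Local Notation mu := (@lebesgue_measure R).
Local Notation intg f := (mu.-integrable setT (EFin \o f)).
Local Notation intg2 f := ((mu \x mu)%E.-integrable setT (EFin \o f)).
Local Notation I f := (Rintegral mu setT f).
Local Notation Rm := (measurableTypeR R).
Local Notation meas2 f := (measurable_fun [set: (Rm * Rm)%type] (f : Rm * Rm -> R)).

Lemma ae_imp (P Q : R -> Prop) : {ae mu, forall x, P x} -> (forall x, P x -> Q x) ->
  {ae mu, forall x, Q x}.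
Proof. by move=> aP PQ; apply: (filterS PQ aP); exact: (ae_filter_ringOfSetsType mu). Qed.

Lemma ae_imp2 (P P' Q : R -> Prop) : {ae mu, forall x, P x} ->
  {ae mu, forall x, P' x} -> (forall x, P x -> P' x -> Q x) ->
  {ae mu, forall x, Q x}.
Proof.
move=> aP aP' PQ.
exact: (@filterS2 _ _ (ae_filter_ringOfSetsType mu) P P' Q PQ aP aP').
Qed.

(* Sections that fail to be integrable form a null set, on which [Rintegral] takes junk values. *)
Lemma intg2_fine (F : R * R -> R) : intg2 F -> intg (fun x => I (fun y => F (x, y))).
Proof.
move=> iF; have iG := integrable_fubini_F iF.
apply: (le_integrable measurableT _ _ iG) => //.
  apply/measurable_EFinP; apply: (measurableT_comp (@fine_measurable R setT measurableT)).
  exact: measurable_int iG.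
move=> x _ /=; rewrite /Rintegral /fubini_F /=.
by case: (\int[_]_y _)%E => //=; rewrite ?normr0 ?leey.
Qed.

Lemma I_fubini1 (F : R * R -> R) : intg2 F ->
  I (fun x => I (fun y => F (x, y))) = fine (\int[mu]_x \int[mu]_y (F (x, y))%:E)%E.
Proof.
move=> iF; congr fine; apply: ae_eq_integral => //.
- by apply/measurable_EFinP; apply: intg_meas; exact: intg2_fine.
- exact: (measurable_int _ (integrable_fubini_F iF)).
- apply: ae_imp (ae_integrable1 iF) _ => x ix _ /=; rewrite I_fin//; exact: ix.
Qed.

(** Integrability on the product is read off from an iterated integral of the absolute value;
    exchanging the variables exchanges the two Tonelli criteria. *)
Lemma intg2_swap (F : R * R -> R) : intg2 F -> intg2 (fun z => F (z.2, z.1)).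
Proof.
move=> iF; have mF : meas2 F by apply/measurable_EFinP; exact: measurable_int iF.
have mS : meas2 (fun z => F (z.2, z.1)).
  by apply: (measurableT_comp mF); exact: measurable_fun_pair.
apply/integrable21ltyP; first exact/measurable_EFinP.
have /= := (integrable12ltyP _ _ ((measurable_EFinP _ _).2 mF)).1 iF.
apply: le_lt_trans; rewrite le_eqVlt; apply/orP; left; apply/eqP.
by apply: eq_integral => y _; apply: eq_integral.
Qed.

Lemma I_fubini (F : R * R -> R) : intg2 F ->
  I (fun x => I (fun y => F (x, y))) = I (fun y => I (fun x => F (x, y))).
Proof.
move=> iF; rewrite I_fubini1// (I_fubini1 (intg2_swap iF)) /=.
by congr fine; exact: (Fubini iF).
Qed.

Definition cig2 (F : R * R -> C) : Prop :=
  intg2 (fun z => complex.Re (F z)) /\ intg2 (fun z => complex.Im (F z)).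
Definition cmeas2 (F : R * R -> C) : Prop :=
  meas2 (fun z => complex.Re (F z)) /\ meas2 (fun z => complex.Im (F z)).

Lemma cint_fubini (F : R * R -> C) : cig2 F ->
  cint (fun x => cint (fun y => F (x, y))) = cint (fun y => cint (fun x => F (x, y))).
Proof.
by move=> [Fr Fi]; rewrite /cint /reF /imF /=; rewrite (I_fubini Fr) (I_fubini Fi).
Qed.

Lemma cig2_cint (F : R * R -> C) : cig2 F -> cintegrable (fun x => cint (fun y => F (x, y))).
Proof. by move=> [Fr Fi]; split; [exact: (intg2_fine Fr)|exact: (intg2_fine Fi)]. Qed.

Lemma cig2_ae (F : R * R -> C) : cig2 F ->
  {ae mu, forall x, cintegrable (fun y => F (x, y))}.
Proof.
move=> [Fr Fi]; apply: ae_imp2 (ae_integrable1 Fr) (ae_integrable1 Fi) _.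
by move=> x ? ?; split.
Qed.

Lemma cmeas2M (F G : R * R -> C) : cmeas2 F -> cmeas2 G -> cmeas2 (fun z => F z * G z).
Proof.
move=> [Fr Fi] [Gr Gi]; split.
  rewrite (_ : (fun z => _) = (fun z => complex.Re (F z) * complex.Re (G z)
     - complex.Im (F z) * complex.Im (G z))).
    by apply: measurable_funB; apply: measurable_funM.
  by apply/funext => x; case: (F x) (G x) => ? ? [].
rewrite (_ : (fun z => _) = (fun z => complex.Re (F z) * complex.Im (G z)
     + complex.Im (F z) * complex.Re (G z))).
  by apply: measurable_funD; apply: measurable_funM.
by apply/funext => x; case: (F x) (G x) => ? ? [].
Qed.

Lemma cmeas2_comp (f : R -> C) (u : R * R -> R) : cmeas f -> meas2 u ->
  cmeas2 (fun z => f (u z)).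
Proof.
by move=> [fr fi] mu_; split; [exact: (measurableT_comp fr)|exact: (measurableT_comp fi)].
Qed.

Lemma intg2_le (F G : R * R -> R) : meas2 F -> (forall z, `|F z| <= G z) ->
  intg2 G -> intg2 F.
Proof.
move=> mf fg ig; apply: (le_integrable _ _ _ ig) => //; first exact/measurable_EFinP.
by move=> x _ /=; rewrite lee_fin (le_trans (fg x)) ?ler_norm.
Qed.

Lemma cig2_le (F : R * R -> C) (G : R * R -> R) : cmeas2 F ->
  (forall z, abs1 (F z) <= G z) -> intg2 G -> cig2 F.
Proof.
move=> [fr fi] fg ig; split; apply: (intg2_le _ _ ig) => // x.
  exact: le_trans (abs1_Re _) (fg x).
exact: le_trans (abs1_Im _) (fg x).
Qed.

Lemma meas_fst_comp (f : R -> R) : measurable_fun setT f -> meas2 (fun z => f z.1).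
Proof. by move=> mf; apply: (measurableT_comp mf); exact: measurable_fst. Qed.

Lemma meas_snd_comp (f : R -> R) : measurable_fun setT f -> meas2 (fun z => f z.2).
Proof. by move=> mf; apply: (measurableT_comp mf); exact: measurable_snd. Qed.

Lemma intg2_prod (u v : R -> R) : intg u -> intg v -> intg2 (fun z => u z.1 * v z.2).
Proof.
move=> iu iv; have mu_ := intg_meas iu; have mv := intg_meas iv.
apply/integrable12ltyP.
  by apply/measurable_EFinP/measurable_funM; [exact: meas_fst_comp|exact: meas_snd_comp].
have E (x : R) : (\int[mu]_y `|(u x * v y)%:E| = (`|u x| * I (fun y => `|v y|))%:E)%E.
  rewrite -IZ; last exact: intg_norm.
  rewrite I_fin; last exact/intgZ/intg_norm.
  by apply: eq_integral => y _; rewrite /= normrM.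
under eq_integral do rewrite E.
have ir : intg (fun x => I (fun y => `|v y|) * `|u x|) by apply/intgZ/intg_norm.
under eq_integral do rewrite mulrC.
by rewrite -I_fin// ltry.
Qed.

(** The multiplication formula for a bounded kernel. It serves for the Fourier kernel against a
    damped exponential, for the Poisson kernel against the indicator of an interval, and for the
    Fourier kernel against psi in the tempered identity. *)
Lemma cint_swap (g h : R -> C) (k : R * R -> C) (M : R) :
  cintegrable g -> cintegrable h -> cmeas2 k -> (forall z, abs1 (k z) <= M) ->
  cint (fun x => g x * cint (fun y => h y * k (x, y))) =
  cint (fun y => h y * cint (fun x => g x * k (x, y))).
Proof.
move=> ig ih mk kM.
have M0 : 0 <= M by apply: le_trans (kM (0, 0)); exact: abs1_ge0.
have iF : cig2 (fun z => g z.1 * h z.2 * k z).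
  apply: (@cig2_le _ (fun z => abs1 (g z.1) * (M * abs1 (h z.2)))).
  - apply: cmeas2M mk; apply: cmeas2M.
      by apply: cmeas2_comp (cig_meas ig) _; exact: measurable_fst.
    by apply: cmeas2_comp (cig_meas ih) _; exact: measurable_snd.
  - move=> z; apply: le_trans (abs1M _ _) _; rewrite mulrCA mulrC.
    apply: ler_pM; rewrite ?abs1_ge0//; exact: abs1M.
  - exact: (intg2_prod (cig_abs1 ig) (intgZ M (cig_abs1 ih))).
have mk1 x : cmeas (fun y => k (x, y)).
  by case: mk => [kr ki]; split; apply: (measurableT_comp (f := fun z => _ (k z))) => //; exact: measurable_pair1.
have mk2 y : cmeas (fun x => k (x, y)).
  by case: mk => [kr ki]; split; apply: (measurableT_comp (f := fun z => _ (k z))) => //; exact: measurable_pair2.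
have := cint_fubini iF; rewrite /=.
rewrite (@cint_ext _ _ (fun x => g x * cint (fun y => h y * k (x, y)))); last first.
  move=> x; rewrite -cintZ; last by apply: cigMb (mk1 x) _ => // y; exact: kM.
  by apply: cint_ext => y; rewrite mulrA.
move=> ->; apply: cint_ext => y; rewrite -cintZ; last by apply: cigMb (mk2 y) _ => // x; exact: kM.
by apply: cint_ext => x; rewrite mulrA (mulrC (h y)).
Qed.

(** The translated measure has the right value on half-open intervals, and these values determine
    Lebesgue measure. *)
Lemma lebesgue_shift (a : R) (A : set R) : measurable A ->
  pushforward mu ((fun x => x - a) : _ -> measurableTypeR R) A = mu A.
Proof.
move=> mA; apply/esym/lebesgue_measure_unique => //=; first exact: measurable_funB.
move=> mf _ [[b c]] _ <-; rewrite /pushforward /=.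
rewrite (_ : _ @^-1` _ = `](b + a), (c + a)]%classic); last first.
  by apply/seteqP; split => x /=; rewrite !in_itv /= ltrBrDr lerBlDr.
by rewrite !lebesgue_measure_itv /= !lte_fin ltrD2r -!EFinB; case: ifP => // _; congr EFin; ring.
Qed.

(** The nonnegative case comes first: applied to the absolute value it yields the integrability that
    the change of variables for signed functions requires. *)
Lemma ge0_integral_shift (a : R) (f : R -> R) : measurable_fun setT f ->
  (forall x, 0 <= f x) ->
  (\int[mu]_x (f (x - a))%:E = \int[mu]_x (f x)%:E)%E.
Proof.
move=> mf f0.
have ms : measurable_fun [set: Rm] ((fun x => x - a) : Rm -> Rm).
  exact: measurable_funB.
have := @ge0_integral_pushforward _ _ _ _ R _ ms mu setT (EFin \o f) measurableT
  ((measurable_EFinP _ _).2 mf) (fun y _ => f0 y).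
rewrite preimage_setT /= => <-.
apply: eq_measure_integral => //= A mA _.
exact: lebesgue_shift.
Qed.

Lemma intg_shift (a : R) (f : R -> R) : intg f -> intg (fun x => f (x - a)).
Proof.
move=> fi; have mf := intg_meas fi; apply/integrableP; split.
  by apply/measurable_EFinP; apply: (measurableT_comp mf); exact: measurable_funB.
rewrite /= (@ge0_integral_shift a (fun x => `|f x|)) //; last exact: measurableT_comp.
by rewrite -I_fin ?ltry//; exact: intg_norm.
Qed.

Lemma I_shift (a : R) (f : R -> R) : intg f -> I (fun x => f (x - a)) = I f.
Proof.
move=> fi; congr fine; have mf := intg_meas fi.
have ms : measurable_fun [set: Rm] ((fun x => x - a) : Rm -> Rm).
  exact: measurable_funB.
have := @integral_pushforward _ _ _ _ R _ ms mu setT (EFin \o f)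
  ((measurable_EFinP _ _).2 mf).
rewrite preimage_setT /= => /(_ (intg_shift a fi) measurableT) <-.
apply: eq_measure_integral => //= A mA _.
exact: lebesgue_shift.
Qed.

Lemma cig_shift (a : R) (f : R -> C) : cintegrable f -> cintegrable (fun x => f (x - a)).
Proof. by move=> [fr fi]; split; [exact: (intg_shift a fr)|exact: (intg_shift a fi)]. Qed.

Lemma cint_shift (a : R) (f : R -> C) : cintegrable f -> cint (fun x => f (x - a)) = cint f.
Proof.
by move=> [fr fi]; rewrite /cint; congr (_ +i* _); [exact: (I_shift a fr)|exact: (I_shift a fi)].
Qed.

Definition conv (g h : R -> C) (x : R) : C := cint (fun y => g y * h (x - y)).

(** Integrating in x first, translation invariance turns the inner integral into [norm1 h]. Tonelli
    transfers the value to the other order, the one in which [conv_bound] uses it. *)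
Lemma cig2_conv (g h : R -> C) : cintegrable g -> cintegrable h ->
  intg2 (fun z => abs1 (g z.2) * abs1 (h (z.1 - z.2))) /\
  (\int[mu]_x \int[mu]_y (abs1 (g y) * abs1 (h (x - y)))%:E = (norm1 g * norm1 h)%:E)%E.
Proof.
move=> ig ih; have gm := meas_abs1 (cig_meas ig); have hm := meas_abs1 (cig_meas ih).
have mF : meas2 (fun z => abs1 (g z.2) * abs1 (h (z.1 - z.2))).
  apply: measurable_funM; first exact: (meas_snd_comp gm).
  apply: (measurableT_comp hm); apply: measurable_funB.
    exact: measurable_fst.
  exact: measurable_snd.
have F0 z : (0 <= (abs1 (g z.2) * abs1 (h (z.1 - z.2)))%:E)%E.
  by rewrite lee_fin mulr_ge0 ?abs1_ge0.
have E1 : (\int[mu]_y \int[mu]_x (abs1 (g y) * abs1 (h (x - y)))%:E = (norm1 g * norm1 h)%:E)%E.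
  have E y : (\int[mu]_x (abs1 (g y) * abs1 (h (x - y)))%:E = (norm1 h * abs1 (g y))%:E)%E.
    rewrite -I_fin; last exact/intgZ/(intg_shift y (cig_abs1 ih)).
    rewrite IZ; last exact: (intg_shift y (cig_abs1 ih)).
    by rewrite (I_shift y (cig_abs1 ih)) mulrC.
  under eq_integral do rewrite E.
  rewrite -I_fin; last exact/intgZ/cig_abs1.
  by rewrite IZ ?(mulrC (norm1 g))//; exact: cig_abs1.
split.
  apply/integrable21ltyP; first exact/measurable_EFinP.
  under eq_integral do under eq_integral do rewrite gee0_abs ?F0//.
  by rewrite E1 ltry.
have := @fubini_tonelli _ _ _ _ R mu mu _ ((measurable_EFinP _ _).2 mF) F0.
by rewrite /= => ->.
Qed.

Lemma conv_bound (g h : R -> C) : cintegrable g -> cintegrable h ->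
  cintegrable (conv g h) /\ norm1 (conv g h) <= norm1 g * norm1 h.
Proof.
move=> ig ih; have [iG EG] := cig2_conv ig ih.
have iF : cig2 (fun z => g z.2 * h (z.1 - z.2)).
  apply: (cig2_le _ _ iG); last by move=> z; exact: abs1M.
  apply: cmeas2M; apply: cmeas2_comp; try exact: cig_meas.
    exact: measurable_snd.
  by apply: measurable_funB; [exact: measurable_fst|exact: measurable_snd].
have iK : cintegrable (conv g h) := cig2_cint iF.
split => //.
rewrite /norm1 -lee_fin I_fin; last exact: cig_abs1.
(* Where a section fails to be integrable the inner [Rintegral] carries no information, so the
   comparison is made almost everywhere and the majorant is returned to extended-real integrals
   afterwards. *)
rewrite -EG; apply: (@le_trans _ _ (\int[mu]_x (I (fun y => abs1 (g y) * abs1 (h (x - y))))%:E)%E).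
  apply: ae_ge0_le_integral => //.
  - by move=> x _; rewrite lee_fin abs1_ge0.
  - by apply/measurable_EFinP; exact: (meas_abs1 (cig_meas iK)).
  - by move=> x _; rewrite lee_fin I_ge0// => y; rewrite mulr_ge0 ?abs1_ge0.
  - by apply/measurable_EFinP; apply: intg_meas; exact: (intg2_fine iG).
  - apply: ae_imp2 (cig2_ae iF) (ae_integrable1 iG) _ => x ix iGx _.
    rewrite lee_fin; apply: le_trans (abs1_cint ix) _.
    by apply: norm1_le => // y; exact: abs1M.
rewrite le_eqVlt; apply/orP; left; apply/eqP; apply: ae_eq_integral => //.
- by apply/measurable_EFinP; apply: intg_meas; exact: (intg2_fine iG).
- exact: (measurable_int _ (integrable_fubini_F iG)).
- by apply: ae_imp (ae_integrable1 iG) _ => x ix _ /=; rewrite I_fin//; exact: ix.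
Qed.

Lemma eixD (s t : R) : eix (s + t) = eix s * eix t.
Proof. by rewrite /eix sinD cosD; congr (_ +i* _); rewrite addrC; ring. Qed.

Lemma eix0 : eix (0 : R) = 1.
Proof. by rewrite /eix cos0 sin0. Qed.

Lemma abs1_eix (t : R) : abs1 (eix t) <= 2.
Proof.
rewrite /abs1 /= (_ : 2 = 1 + 1)//; apply: lerD; rewrite ler_norml.
  by rewrite cos_geN1 cos_le1.
by rewrite sin_geN1 sin_le1.
Qed.

Lemma cmeas_eix (x : R) : cmeas (fun t => eix (x * t)).
Proof.
split; apply: cont_meas => t; rewrite /reF /imF /=.
  by apply: (continuous_comp (f := fun t => x * t) (g := cos)); [exact: mulrl_continuous|exact: continuous_cos].
by apply: (continuous_comp (f := fun t => x * t) (g := sin)); [exact: mulrl_continuous|exact: continuous_sin].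
Qed.

Lemma cig_eix (g : R -> C) (x : R) : cintegrable g -> cintegrable (fun t => eix (x * t) * g t).
Proof.
move=> ig; have := cigMb ig (cmeas_eix x) (fun t => abs1_eix (x * t)).
by congr cintegrable; apply/funext => t; rewrite mulrC.
Qed.

Lemma cint_conv (g h : R -> C) (x : R) : cintegrable g -> cintegrable h ->
  cint (fun t => eix (x * t) * conv g h t) =
  cint (fun t => eix (x * t) * g t) * cint (fun t => eix (x * t) * h t).
Proof.
move=> ig ih; have [iG EG] := cig2_conv ig ih.
have mF : cmeas2 (fun z => g z.2 * h (z.1 - z.2)).
  apply: cmeas2M; apply: cmeas2_comp; try exact: cig_meas.
    exact: measurable_snd.
  by apply: measurable_funB; [exact: measurable_fst|exact: measurable_snd].
have iF : cig2 (fun z => g z.2 * h (z.1 - z.2)).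
  by apply: (cig2_le mF _ iG) => z; exact: abs1M.
have iF' : cig2 (fun z => eix (x * z.1) * (g z.2 * h (z.1 - z.2))).
  apply: (@cig2_le _ (fun z => 2 * (abs1 (g z.2) * abs1 (h (z.1 - z.2))))).
  - apply: cmeas2M mF.
    by apply: (cmeas2_comp (cmeas_eix x)); exact: measurable_fst.
  - move=> z; apply: le_trans (abs1M _ _) _; apply: ler_pM; rewrite ?abs1_ge0 ?abs1_eix//.
    exact: abs1M.
  - by have := integrableZl measurableT 2 iG.
(* Moving [eix (x * t)] under the inner integral is done only for almost every t, those whose
   section is integrable. *)
transitivity (cint (fun t => cint (fun y => eix (x * t) * (g y * h (t - y))))).
  apply: cint_ae.
  - by apply: cig_meas; apply: cig_eix; exact: (conv_bound ig ih).1.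
  - exact: (cig_meas (cig2_cint iF')).
  - by apply: ae_imp (cig2_ae iF) _ => t it; rewrite cintZ.
rewrite (cint_fubini iF') /=.
transitivity (cint (fun y => cint (fun t => eix (x * t) * h t) * (eix (x * y) * g y))).
  apply: cint_ext => y; rewrite -(cint_shift y (cig_eix x ih)).
  rewrite mulrC -cintZ; last exact: (cig_shift y (cig_eix x ih)).
  apply: cint_ext => t; rewrite (_ : x * t = x * y + x * (t - y)); last by ring.
  by rewrite eixD; ring.
rewrite cintZ; last exact: (cig_eix x ig).
exact: mulrC.
Qed.

End FubiniConvolution.

(** * Series in the space of integrable functions *)

Section L1Series.
Context {R : realType}.
Local Notation C := R[i].
Local Notation mu := (@lebesgue_measure R).
Local Notation intg f := (mu.-integrable setT (EFin \o f)).
Local Notation I f := (Rintegral mu setT f).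

Lemma intg_sum (u : nat -> R -> R) n : (forall k, intg (u k)) ->
  intg (fun x => \sum_(k < n) u k x).
Proof.
move=> iu; elim: n => [|n IH].
  by under [X in _ \o X]funext do rewrite big_ord0; exact: intg0.
by under [X in _ \o X]funext do rewrite big_ord_recr /=; exact: intgD.
Qed.

(** Completeness of L^1 in the form of Riesz and Fischer: by monotone convergence the sum [G] of the
    absolute values is integrable, hence finite almost everywhere, and it dominates all partial
    sums. *)
Lemma L1_series (u : nat -> R -> R) (M : R) : (forall n, intg (u n)) ->
  (forall n, \sum_(k < n) I (fun x => `|u k x|) <= M) ->
  exists U : R -> R, intg U /\
    I (fun x => `|U x - \sum_(k < n) u k x|) @[n --> \oo] --> (0 : R).
Proof.
move=> iu uM; have mu_ n := intg_meas (iu n).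
pose G x : \bar R := (\sum_(n <oo) `|u n x|%:E)%E.
have mabs n : measurable_fun setT (fun x => `|u n x|) by exact: measurableT_comp.
have mG : measurable_fun setT G.
  have := @ge0_emeasurable_sum _ _ R setT (fun n x => `|u n x|%:E) xpredT.
  apply => [n x _ _|n _]; first by rewrite lee_fin.
  exact/measurable_EFinP.
have G0 x : (0 <= G x)%E by apply: nneseries_ge0 => n _ _; rewrite lee_fin.
have iG : mu.-integrable setT G.
  apply/integrableP; split => //.
  under eq_integral do rewrite gee0_abs//.
  rewrite integral_nneseries//=; last first.
    by move=> n; apply/measurable_EFinP; exact: mabs.
  apply: (@le_lt_trans _ _ M%:E); last exact: ltry.
  apply: lime_le; first by apply: is_cvg_nneseries => n _ _; apply: integral_ge0 => x _; rewrite lee_fin.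
  apply: nearW => n; rewrite big_mkord.
  rewrite (eq_bigr (fun k : 'I_n => (I (fun x => `|u k x|))%:E)); last first.
    by move=> k _; rewrite I_fin//; exact: intg_norm.
  by rewrite sumEFin lee_fin; exact: uM.
pose D := [set x | G x \is a fin_num].
have mD : measurable D.
  have -> : D = [set: R] `&` [set x | G x \is a fin_num] by rewrite setTI.
  exact: emeasurable_fin_num.
have aD : {ae mu, forall x, D x}.
  by apply: ae_imp (integrable_ae measurableT iG) _ => x; exact.
(* Terms are set to 0 outside [D], so that the partial sums converge at every point and are bounded
   at every point by the finite function [g], as [I_dct] demands. *)
pose v n x := u n x * \1_D x.
have mv n : measurable_fun setT (v n) by apply: measurable_funM => //; exact: measurable_indic.
pose g x := fine (G x).
have ig : intg g.
  apply: (le_integrable _ _ _ iG) => //.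
    by apply/measurable_EFinP; apply: (measurableT_comp (@fine_measurable R setT measurableT)).
  move=> x _ /=; rewrite /g.
  by case: (G x) => //=; rewrite ?normr0 ?leey.
have g0 x : 0 <= g x by apply: fine_ge0.
have vg n x : \sum_(k < n) `|v k x| <= g x.
  have [Dx|Dx] := pselect (D x); last first.
    rewrite big1// => k _; by rewrite /v indicE memNset// mulr0 normr0.
  rewrite -lee_fin /g fineK// -sumEFin.
  rewrite (eq_bigr (fun k : 'I_n => `|u k x|%:E)); last first.
    by move=> k _; rewrite /v indicE mem_set// mulr1.
  rewrite -(big_mkord xpredT (fun k => `|u k x|%:E)).
  by apply: nneseries_lim_ge => k _ _; rewrite lee_fin.
pose S n x := \sum_(k < n) v k x.
have Sg n x : `|S n x| <= g x by apply: le_trans (ler_norm_sum _ _ _) (vg n x).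
pose U x : R := limn (S ^~ x).
have SU x : S n x @[n --> \oo] --> U x.
  suff : cvgn (series (v ^~ x)) by rewrite /U /S (_ : series _ = fun n => \sum_(k < n) v k x)// seriesEord.
  apply: normed_cvg; apply: nondecreasing_is_cvgn.
    by apply: nondecreasing_series => n _ _ /=; exact: normr_ge0.
  exists (g x) => _ [n _ <-] /=; rewrite /series /= big_mkord; exact: vg.
have mS n : measurable_fun setT (S n) by exact: measurable_sum.
have mU : measurable_fun setT U.
  by apply: (measurable_fun_cvg mS) => x _; exact: SU.
have Ug x : `|U x| <= g x.
  have h : `|S n x| @[n --> \oo] --> `|U x| by apply: cvg_norm; exact: SU.
  by apply: (cvgr_to_le h); exact: nearW.
have iU : intg U := intg_le mU Ug ig.
exists U; split => //.
have -> : (fun n => I (fun x => `|U x - \sum_(k < n) u k x|)) =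
    (fun n => I (fun x => `|U x - S n x|)).
  apply/funext => n; apply: I_ae.
  - apply: measurableT_comp => //; apply: measurable_funB => //.
    exact: (intg_meas (intg_sum n iu)).
  - by apply: measurableT_comp => //; apply: measurable_funB.
  - apply: ae_imp aD _ => x Dx; rewrite /S; congr (`|_ - _|).
    by apply: eq_bigr => k _; rewrite /v indicE mem_set// mulr1.
have [|||||_] := @I_dct R (fun n x => `|U x - S n x|) (fun=> 0) (fun x => g x + g x).
- by move=> n; apply: measurableT_comp => //; apply: measurable_funB.
- exact: measurable_cst.
- apply: aeW => x.
  have h : U x - S n x @[n --> \oo] --> (0 : R).
    by rewrite -(subrr (U x)); apply: cvgB; [exact: cvg_cst|exact: SU].
  have : `|U x - S n x| @[n --> \oo] --> `|0 : R| by apply: cvg_norm.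
  by rewrite normr0.
- exact: intgD.
- move=> n x; rewrite normr_id; apply: le_trans (ler_normB _ _) _.
  by apply: lerD.
by rewrite /Rintegral (integral0).
Qed.

Lemma csum_ReIm (u : nat -> C) n :
  complex.Re (\sum_(k < n) u k) = \sum_(k < n) complex.Re (u k) /\
  complex.Im (\sum_(k < n) u k) = \sum_(k < n) complex.Im (u k).
Proof.
elim: n => [|n [IH1 IH2]]; first by rewrite !big_ord0.
by rewrite !big_ord_recr /= -IH1 -IH2; case: (\sum_(_ < _) u _) (u n) => ? ? [].
Qed.

Lemma cig_sum (u : nat -> R -> C) n : (forall k, cintegrable (u k)) ->
  cintegrable (fun x => \sum_(k < n) u k x).
Proof.
move=> iu; elim: n => [|n IH].
  rewrite (_ : (fun x => _) = (fun=> 0)); first exact: cig0.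
  by apply/funext => x; rewrite big_ord0.
rewrite (_ : (fun x => _) = (fun x => \sum_(k < n) u k x + u n x)); first exact: cigD.
by apply/funext => x; rewrite big_ord_recr.
Qed.

Lemma norm1_series (u : nat -> R -> C) (M : R) : (forall n, cintegrable (u n)) ->
  (forall n, \sum_(k < n) norm1 (u k) <= M) ->
  exists U : R -> C, cintegrable U /\
    norm1 (fun x => U x - \sum_(k < n) u k x) @[n --> \oo] --> (0 : R).
Proof.
move=> iu uM.
have Nle n : \sum_(k < n) I (fun x => `|reF (u k) x|) <= M /\
             \sum_(k < n) I (fun x => `|imF (u k) x|) <= M.
  by split; apply: le_trans (uM n); apply: ler_sum => k _; apply: I_le => [||x];
    [exact: intg_norm (iu k).1|exact: cig_abs1|exact: abs1_Re
    |exact: intg_norm (iu k).2|exact: cig_abs1|exact: abs1_Im].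
have [U1 [iU1 c1]] := L1_series (fun n => (iu n).1) (fun n => (Nle n).1).
have [U2 [iU2 c2]] := L1_series (fun n => (iu n).2) (fun n => (Nle n).2).
exists (fun x => U1 x +i* U2 x); split; first by split.
rewrite (_ : (fun n => norm1 _) = (fun n => I (fun x => `|U1 x - \sum_(k < n) reF (u k) x|) +
    I (fun x => `|U2 x - \sum_(k < n) imF (u k) x|))).
  by have := cvgD c1 c2; rewrite addr0; exact.
apply/funext => n; rewrite /norm1 -ID.
- apply: I_ext => x; rewrite /abs1; have [E1 E2] := csum_ReIm (u ^~ x) n.
  by case: (\sum_(k < n) u k x) E1 E2 => a b /= -> ->.
- exact/intg_norm/intgB/(intg_sum n (fun n => (iu n).1)).
- exact/intg_norm/intgB/(intg_sum n (fun n => (iu n).2)).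
Qed.

End L1Series.

(** * The complex exponential series *)

Section ComplexExponential.
Context {R : realType}.
Local Notation C := R[i].

Lemma is_derive_lin (k x : R) : is_derive x 1 (fun t : R => t * k) k.
Proof.
apply: (is_derive_eq (is_deriveM (is_derive_id x 1) (is_derive_cst k x 1))).
by rewrite /GRing.scale /=; ring.
Qed.

Lemma is_derive_mull (k x : R) : is_derive x 1 (fun t : R => k * t) k.
Proof.
apply: (is_derive_eq (is_deriveM (is_derive_cst k x 1) (is_derive_id x 1))).
by rewrite /GRing.scale /=; ring.
Qed.

Definition cis_derive (f : R -> C) (x : R) (d : C) : Prop :=
  is_derive x 1 (reF f) (complex.Re d) /\ is_derive x 1 (imF f) (complex.Im d).

Lemma cis_deriveD (f g : R -> C) x df dg : cis_derive f x df -> cis_derive g x dg ->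
  cis_derive (fun t => f t + g t) x (df + dg).
Proof.
case: df dg => [a b] [c d] [fr fi] [gr gi].
by split; rewrite ?reFD ?imFD; [exact: (is_deriveD fr gr)|exact: (is_deriveD fi gi)].
Qed.

Lemma cis_deriveM (f g : R -> C) x df dg : cis_derive f x df -> cis_derive g x dg ->
  cis_derive (fun t => f t * g t) x (df * g x + f x * dg).
Proof.
case: df dg => [a b] [c d] [fr fi] [gr gi] /=.
split; rewrite ?reFM ?imFM.
  apply: (is_derive_eq (is_deriveB (is_deriveM fr gr) (is_deriveM fi gi))).
  rewrite /GRing.scale /= /reF /imF; case: (f x) (g x) => ? ? [? ?] /=; ring.
apply: (is_derive_eq (is_deriveD (is_deriveM fr gi) (is_deriveM fi gr))).
rewrite /GRing.scale /= /reF /imF; case: (f x) (g x) => ? ? [? ?] /=; ring.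
Qed.

Lemma cis_derive_cst (z : C) x : cis_derive (fun=> z) x 0.
Proof. by split; exact: is_derive_cst. Qed.

Lemma cis_derive_line (z : C) x : cis_derive (fun t => t%:C * z) x z.
Proof.
have cid : cis_derive (fun t => t%:C) x 1.
  by split; [exact: is_derive_id|exact: is_derive_cst].
have := cis_deriveM cid (cis_derive_cst z x).
by rewrite mul1r mulr0 addr0.
Qed.

Lemma cis_derive_exp (z : C) x :
  cis_derive (fun t => cexp (t%:C * z)) x (z * cexp (x%:C * z)).
Proof.
case: z => a b.
have l k := is_derive_lin k x.
have E (t : R) : cexp (t%:C * (a +i* b)) =
    (expR (t * a) * cos (t * b)) +i* (expR (t * a) * sin (t * b)).
  rewrite /cexp /eix /=; congr (_ +i* _); rewrite !mul0r ?subr0 ?addr0; congr (_ * _); congr (_ _); ring.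
have ee := is_derive1_comp (g := fun t : R => t * a) (is_derive_expR (x * a)) (l a).
have ec := is_derive1_comp (g := fun t : R => t * b) (is_derive_cos (x * b)) (l b).
have es := is_derive1_comp (g := fun t : R => t * b) (is_derive_sin (x * b)) (l b).
split.
  rewrite (_ : reF _ = fun t => expR (t * a) * cos (t * b)); last first.
    by apply/funext => t; rewrite /reF E.
  apply: (is_derive_eq (is_deriveM ee ec)); rewrite E /GRing.scale /=; ring.
rewrite (_ : imF _ = fun t => expR (t * a) * sin (t * b)); last first.
  by apply/funext => t; rewrite /imF E.
apply: (is_derive_eq (is_deriveM ee es)); rewrite E /GRing.scale /=; ring.
Qed.

Lemma MVT_bound (f df : R -> R) (M : R) : (forall t : R, is_derive t 1 f (df t)) ->
  (forall t, 0 <= t <= 1 -> `|df t| <= M) -> `|f 1 - f 0| <= M.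
Proof.
move=> fd dM.
have fc : {within `[0, 1], continuous f}.
  apply: continuous_subspaceT => x.
  by apply/differentiable_continuous/derivable1_diffP; case: (fd x).
have [c c01 ->] := @MVT_segment R f df 0 1 ler01 (fun x _ => fd x) fc.
by rewrite subr0 mulr1; apply: dM; rewrite in_itv in c01.
Qed.

(** Counted by number of terms: the degree is n - 1, and differentiating along a ray lowers the
    index by one. *)
Definition exp_sum (z : C) n : C := \sum_(k < n) (k`!%:R^-1)%:C * z ^+ k.

Lemma abs1X (z : C) n : abs1 (z ^+ n) <= abs1 z ^+ n.
Proof.
elim: n => [|n IH]; first by rewrite !expr0 /abs1 /= normr0 normr1 addr0.
by rewrite !exprS; apply: le_trans (abs1M _ _) _; rewrite ler_wpM2l ?abs1_ge0.
Qed.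

Lemma exp_sumD (z : C) n x :
  cis_derive (fun t => exp_sum (t%:C * z) n.+1) x (z * exp_sum (x%:C * z) n).
Proof.
elim: n => [|n IH].
  rewrite /exp_sum big_ord0 mulr0 (_ : (fun t => _) = fun=> 1); first exact: cis_derive_cst.
  by apply/funext => t; rewrite big_ord_recr big_ord0 /= add0r fact0 invr1 expr0 mulr1.
have pw m : cis_derive (fun t => (t%:C * z) ^+ m.+1) x (m.+1%:R * (x%:C * z) ^+ m * z).
  elim: m => [|m IHm].
    rewrite expr0 !mul1r (_ : (fun t => _) = fun t => t%:C * z); first exact: cis_derive_line.
    by apply/funext => t; rewrite expr1.
  rewrite (_ : (fun t => _) = fun t => (t%:C * z) * (t%:C * z) ^+ m.+1); last first.
    by apply/funext => t; rewrite exprS.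
  have := cis_deriveM (cis_derive_line z x) IHm.
  congr cis_derive; rewrite [in RHS]mulrS [(x%:C * z) ^+ m.+1]exprS; ring.
rewrite (_ : (fun t => _) = fun t => exp_sum (t%:C * z) n.+1 +
    (n.+1`!%:R^-1)%:C * (t%:C * z) ^+ n.+1); last first.
  by apply/funext => t; rewrite /exp_sum big_ord_recr.
have := cis_deriveD IH (cis_deriveM (cis_derive_cst ((n.+1`!%:R^-1)%:C : C) x) (pw n)).
congr cis_derive; rewrite mul0r add0r [exp_sum _ n.+1]/exp_sum big_ord_recr /= -/(exp_sum _ n).
rewrite mulrDr; congr (_ + _).
have -> : (n`!%:R^-1)%:C = (n.+1`!%:R^-1)%:C * n.+1%:R :> C.
  rewrite -(rmorph_nat (real_complex R)) -rmorphM /=; congr (_%:C).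
  by rewrite factS natrM invfM mulrAC mulVf ?mul1r// pnatr_eq0.
by ring.
Qed.

Lemma cexp0 : cexp 0 = 1 :> C.
Proof. by rewrite /cexp /= expR0 eix0 mulr1. Qed.

Lemma cexpD (z w : C) : cexp (z + w) = cexp z * cexp w.
Proof.
case: z w => [a b] [c d]; rewrite /cexp /= expRD eixD rmorphM /=; ring.
Qed.

Lemma abs1_cexp (z : C) : abs1 (cexp z) <= expR `|complex.Re z| * 2.
Proof.
rewrite /cexp; apply: le_trans (abs1M _ _) _; apply: ler_pM; rewrite ?abs1_ge0 ?abs1_eix//.
by rewrite abs1_real ger0_norm ?expR_ge0// ler_expR ler_norm.
Qed.

(* The derivative of [e^(-tz) P(tz)], P the Taylor polynomial of degree n, is
   [- z e^(-tz) (tz)^n / n!]. *)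
Lemma exp_sum_err (z : C) : exists K : R, forall n,
  abs1 (cexp z - exp_sum z n.+1) <= K * exp_coeff (abs1 z) n.
Proof.
pose B := expR `|complex.Re z| * 2 : R.
have B0 : 0 <= B by rewrite mulr_ge0 ?expR_ge0.
exists (B * (2 * (abs1 z * B))) => n.
pose H (t : R) := cexp (t%:C * (- z)) * exp_sum (t%:C * z) n.+1.
pose dH (t : R) := - z * cexp (t%:C * (- z)) * ((n`!%:R^-1)%:C * (t%:C * z) ^+ n).
have HD t : cis_derive H t (dH t).
  have := cis_deriveM (cis_derive_exp (- z) t) (exp_sumD z n t).
  congr cis_derive; rewrite /dH [exp_sum _ n.+1]/exp_sum big_ord_recr /= -/(exp_sum _ n); ring.
have dHM t : 0 <= t <= 1 -> abs1 (dH t) <= abs1 z * B * exp_coeff (abs1 z) n.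
  move=> /andP[t0 t1]; rewrite /dH; apply: le_trans (abs1M _ _) _.
  apply: ler_pM; rewrite ?abs1_ge0//.
    apply: le_trans (abs1M _ _) _; rewrite abs1N ler_wpM2l ?abs1_ge0//.
    apply: le_trans (abs1_cexp _) _; rewrite ler_wpM2r// ler_expR.
    case: (z) => a b /=; rewrite mul0r subr0 normrM normrN ger0_norm//.
    by rewrite ler_piMl.
  apply: le_trans (abs1M _ _) _; rewrite abs1_real ger0_norm ?invr_ge0//.
  rewrite exp_coeffE /=  ler_wpM2l ?invr_ge0//.
  apply: le_trans (abs1X _ _) _; apply: lerXn2r; rewrite ?nnegrE ?abs1_ge0//.
  apply: le_trans (abs1M _ _) _; rewrite abs1_real ger0_norm//.
  by rewrite ler_piMl ?abs1_ge0.
(* The mean value theorem is one for real functions; it is applied to the real and imaginary parts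
   separately, at the cost of the factor 2. *)
have H1 : abs1 (H 1 - H 0) <= 2 * (abs1 z * B * exp_coeff (abs1 z) n).
  rewrite (_ : 2 = 1 + 1)// mulrDl mul1r; apply: lerD.
    have := @MVT_bound (reF H) (fun t => complex.Re (dH t)) _ (fun t => (HD t).1)
      (fun t ht => le_trans (abs1_Re _) (dHM t ht)).
    by rewrite /reF; case: (H 1) (H 0) => ? ? [].
  have := @MVT_bound (imF H) (fun t => complex.Im (dH t)) _ (fun t => (HD t).2)
    (fun t ht => le_trans (abs1_Im _) (dHM t ht)).
  by rewrite /imF; case: (H 1) (H 0) => ? ? [].
have H0E : H 0 = 1.
  rewrite /H !mul0r cexp0 mul1r /exp_sum big_ord_recl /= expr0 fact0 invr1 mulr1.
  by rewrite big1 ?addr0// => i _; rewrite exprS mul0r mulr0.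
have cE : cexp z * cexp (- z) = 1 by rewrite -cexpD subrr cexp0.
have -> : cexp z - exp_sum z n.+1 = - (cexp z * (H 1 - H 0)).
  have e1 : 1%:C = 1 :> C by [].
  rewrite H0E /H e1 !mul1r mulrBr mulrA cE; ring.
rewrite abs1N; apply: le_trans (abs1M _ _) _.
apply: (@le_trans _ _ (B * (2 * (abs1 z * B * exp_coeff (abs1 z) n)))); last by rewrite !mulrA.
by apply: ler_pM; rewrite ?abs1_ge0//; exact: abs1_cexp.
Qed.

End ComplexExponential.

(** * Regularity of inverse Fourier transforms *)

Section FourierRegularity.
Context {R : realType}.
Local Notation C := R[i].
Local Notation mu := (@lebesgue_measure R).
Local Notation intg f := (mu.-integrable setT (EFin \o f)).
Local Notation I f := (Rintegral mu setT f).

(** The real part of the integral of e^(ixt) (u + iv). The imaginary part is the same expression for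
    the pair (v, -u), so each real lemma below serves both parts. *)
Definition trig_int (u v : R -> R) (x : R) : R :=
  I (fun t => cos (x * t) * u t - sin (x * t) * v t).

Lemma cos_le1n (t : R) : `|cos t| <= 1.
Proof. by rewrite ler_norml cos_geN1 cos_le1. Qed.

Lemma sin_le1n (t : R) : `|sin t| <= 1.
Proof. by rewrite ler_norml sin_geN1 sin_le1. Qed.

Lemma intg_trig (u v : R -> R) x : intg u -> intg v ->
  intg (fun t => cos (x * t) * u t - sin (x * t) * v t).
Proof.
move=> iu iv; have [mc ms] := cmeas_eix x.
have := intgB (intgM iu mc (fun t => cos_le1n (x * t))) (intgM iv ms (fun t => sin_le1n (x * t))).
by congr (_.-integrable _ (_ \o _)); apply/funext => t; rewrite /reF /imF /= mulrC (mulrC (v t)).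
Qed.

Lemma trig_le (u v : R -> R) x t :
  `|cos (x * t) * u t - sin (x * t) * v t| <= `|u t| + `|v t|.
Proof.
apply: le_trans (ler_normB _ _) _; rewrite !normrM.
by apply: lerD; rewrite ler_piMl ?cos_le1n ?sin_le1n.
Qed.

Lemma is_derive_trig (a b t x : R) :
  is_derive x 1 (fun x => cos (x * t) * a - sin (x * t) * b)
    (cos (x * t) * (- t * b) - sin (x * t) * (t * a)).
Proof.
have dc := is_derive1_comp (g := fun y : R => y * t) (is_derive_cos (x * t)) (is_derive_lin t x).
have ds := is_derive1_comp (g := fun y : R => y * t) (is_derive_sin (x * t)) (is_derive_lin t x).
apply: (is_derive_eq (is_deriveB (is_deriveM dc (is_derive_cst a x 1))
  (is_deriveM ds (is_derive_cst b x 1)))).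
rewrite /GRing.scale /=; ring.
Qed.

Lemma derivable_continuous (f : R -> R) x : derivable f x 1 -> {for x, continuous f}.
Proof. by move=> /derivable1_diffP/differentiable_continuous. Qed.

Lemma trig_int_continuous (u v : R -> R) : intg u -> intg v -> continuous (trig_int u v).
Proof.
move=> iu iv x.
apply: (@continuity_under_integral R _ _ mu
  (fun x t => cos (x * t) * u t - sin (x * t) * v t) setT measurableT (x - 1) (x + 1) _ _
  (fun t => `|u t| + `|v t|)).
- by move=> y _; exact: intg_trig.
- apply: aeW => t _ y _; apply: derivable_continuous.
  by case: (is_derive_trig (u t) (v t) t y).
- by apply: intgD; exact: intg_norm.
- by move=> y _; apply: aeW => t _; exact: trig_le.
- by rewrite inE /= in_itv /=; apply/andP; split; lra.
Qed.

Lemma trig_int_derive (u v : R -> R) x : intg u -> intg v ->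
  intg (fun t => t * u t) -> intg (fun t => t * v t) ->
  derive1 (trig_int u v) x = trig_int (fun t => - t * v t) (fun t => t * u t) x.
Proof.
move=> iu iv itu itv.
rewrite (@differentiation_under_integral R _ _ mu
  (fun x t => cos (x * t) * u t - sin (x * t) * v t) setT measurableT x (x - 1) (x + 1) _ _ _
  (fun t => `|t * u t| + `|t * v t|)).
- apply: eq_Rintegral => t _; rewrite partial1of2E.
  by case: (is_derive_trig (u t) (v t) t x).
- by rewrite /= in_itv /=; apply/andP; split; lra.
- by move=> y _; exact: intg_trig.
- by move=> y t _ _; case: (is_derive_trig (u t) (v t) t y).
- by move=> t; rewrite addr_ge0.
- by apply: intgD; exact: intg_norm.
- move=> y t _ _; rewrite partial1of2E; case: (is_derive_trig (u t) (v t) t y) => _ ->.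
  apply: le_trans (trig_le (fun t => - t * v t) (fun t => t * u t) y t) _.
  by rewrite mulNr normrN addrC.
Qed.

Local Notation c0 := ((2 * pi)^-1 : R).

Lemma reF_ifourier (g : R -> C) : reF (ifourier g) = fun x => c0 * trig_int (reF g) (imF g) x.
Proof.
apply/funext => x; rewrite /reF /ifourier /= mul0r subr0; congr (_ * _).
by rewrite (reFM (fun t => eix (x * t)) g).
Qed.

Lemma imF_ifourier (g : R -> C) :
  imF (ifourier g) = fun x => c0 * trig_int (imF g) (fun t => - reF g t) x.
Proof.
apply/funext => x; rewrite /imF /ifourier /= mul0r addr0; congr (_ * _).
rewrite (imFM (fun t => eix (x * t)) g); apply: I_ext => t.
by rewrite mulrN opprK.
Qed.

Lemma ifourier_continuous (g : R -> C) : cintegrable g -> ccontinuous (ifourier g).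
Proof.
move=> [gr gi]; split; rewrite ?reF_ifourier ?imF_ifourier => x.
  by apply: cvgM; [exact: cvg_cst|exact: (trig_int_continuous gr gi)].
by apply: cvgM; [exact: cvg_cst|exact: (trig_int_continuous gi (intgN gr))].
Qed.

Lemma derive1_scale (k : R) (f : R -> R) x : derivable f x 1 ->
  derive1 (fun x => k * f x) x = k * derive1 f x.
Proof. by move=> fd; rewrite !derive1E (deriveMl k fd). Qed.

Lemma trig_int_derivable (u v : R -> R) x : intg u -> intg v ->
  intg (fun t => t * u t) -> intg (fun t => t * v t) -> derivable (trig_int u v) x 1.
Proof.
move=> iu iv itu itv.
apply: (@derivable_under_integral R _ _ mu
  (fun x t => cos (x * t) * u t - sin (x * t) * v t) setT measurableT x (x - 1) (x + 1) _ _ _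
  (fun t => `|t * u t| + `|t * v t|)).
- by rewrite /= in_itv /=; apply/andP; split; lra.
- by move=> y _; exact: intg_trig.
- by move=> y t _ _; case: (is_derive_trig (u t) (v t) t y).
- by move=> t; rewrite addr_ge0.
- by apply: intgD; exact: intg_norm.
- move=> y t _ _; rewrite partial1of2E; case: (is_derive_trig (u t) (v t) t y) => _ ->.
  apply: le_trans (trig_le (fun t => - t * v t) (fun t => t * u t) y t) _.
  by rewrite mulNr normrN addrC.
Qed.

(** Differentiation under the integral brings down the factor i t; the second hypothesis provides a
    majorant independent of x. *)
Lemma ifourier_derive (g : R -> C) x : cintegrable g ->
  cintegrable (fun t => g t * (0 +i* t)) ->
  cderive1 (ifourier g) x = ifourier (fun t => g t * (0 +i* t)) x.
Proof.
move=> [gr gi] [tr ti].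
have E1 : reF (fun t => g t * (0 +i* t)) = fun t => - t * imF g t.
  by rewrite reFM; apply/funext => t; rewrite /reF /imF /=; ring.
have E2 : imF (fun t => g t * (0 +i* t)) = fun t => t * reF g t.
  by rewrite imFM; apply/funext => t; rewrite /reF /imF /=; ring.
have i1 : intg (fun t => t * imF g t).
  have := intgN tr; congr (_.-integrable _ (_ \o _)); apply/funext => t.
  by have := congr1 (fun f => f t) E1; rewrite /reF => ->; ring.
have i2 : intg (fun t => t * reF g t) by move: ti; rewrite -/(imF _) E2.
have i3 : intg (fun t => t * - reF g t).
  have := intgN i2; congr (_.-integrable _ (_ \o _)).
  by apply/funext => t; rewrite mulrN.
apply/eqP; rewrite eq_complex; apply/andP; split; apply/eqP.
  change (derive1 (reF (ifourier g)) x = reF (ifourier (fun t => g t * (0 +i* t))) x).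
  rewrite !reF_ifourier E1 E2 derive1_scale; last exact: trig_int_derivable.
  by rewrite trig_int_derive.
change (derive1 (imF (ifourier g)) x = imF (ifourier (fun t => g t * (0 +i* t))) x).
rewrite !imF_ifourier E1 E2 derive1_scale; last exact: (trig_int_derivable gi (intgN gr)).
rewrite (trig_int_derive x gi (intgN gr))//; congr (_ * _); apply: I_ext => t; ring.
Qed.

End FourierRegularity.

(** * The Wiener algebra *)

Section WienerAlgebra.
Context {R : realType}.
Local Notation C := R[i].
Local Notation mu := (@lebesgue_measure R).
Local Notation c0 := ((2 * pi)^-1 : R).
Implicit Types g h : R -> C.

Lemma c0_ge0 : 0 <= c0.
Proof. by rewrite invr_ge0 mulr_ge0// pi_ge0. Qed.

Lemma c0_le : c0 <= 4^-1.
Proof.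
rewrite lef_pV2 ?posrE ?mulr_gt0 ?pi_gt0//.
by have := @pi_ge2 R; lra.
Qed.

(** The factor [c0] makes the norm submultiplicative: a product of inverse transforms is the inverse
    transform of [c0] times the convolution. *)
Definition wnorm g : R := c0 * norm1 g.

Lemma wnorm_ge0 g : 0 <= wnorm g.
Proof. by rewrite mulr_ge0 ?c0_ge0 ?norm1_ge0. Qed.

Lemma wnormD g h : cintegrable g -> cintegrable h -> wnorm (fun t => g t + h t) <= wnorm g + wnorm h.
Proof. by move=> ig ih; rewrite /wnorm -mulrDr ler_wpM2l ?c0_ge0 ?norm1D. Qed.

Lemma wnormMb g m (M : R) : cintegrable g -> cmeas m -> (forall x, abs1 (m x) <= M) ->
  wnorm (fun t => g t * m t) <= M * wnorm g.
Proof. by move=> ig mm mM; rewrite /wnorm mulrCA ler_wpM2l ?c0_ge0 ?(norm1Mb ig mm mM). Qed.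

Lemma ifourierD g h x : cintegrable g -> cintegrable h ->
  ifourier (fun t => g t + h t) x = ifourier g x + ifourier h x.
Proof.
move=> ig ih; rewrite /ifourier -mulrDr -cintD; try exact: cig_eix.
by congr (_ * _); apply: cint_ext => t; rewrite mulrDr.
Qed.

Lemma ifourierZ z g x : cintegrable g -> ifourier (fun t => z * g t) x = z * ifourier g x.
Proof.
move=> ig; rewrite /ifourier [RHS]mulrCA; congr (_ * _).
rewrite -(cintZ z (cig_eix x ig)); apply: cint_ext => t; exact: mulrCA.
Qed.

(** This control of the supremum is what carries pointwise identities between inverse transforms
    through limits in norm. The 2 is the bound on [abs1 (eix t)]. *)
Lemma ifourier_abs1 g x : cintegrable g -> abs1 (ifourier g x) <= 2 * wnorm g.
Proof.
move=> ig; rewrite /ifourier /wnorm; apply: le_trans (abs1M _ _) _.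
rewrite abs1_real ger0_norm ?c0_ge0// mulrCA ler_wpM2l ?c0_ge0//.
apply: le_trans (abs1_cint (cig_eix x ig)) _.
have := norm1Mb ig (cmeas_eix x) (fun t => abs1_eix (x * t)).
by apply: le_trans; rewrite le_eqVlt; apply/orP; left; apply/eqP; apply: I_ext => t; rewrite mulrC.
Qed.

Lemma wiener_mul g h : cintegrable g -> cintegrable h -> exists k,
  [/\ cintegrable k, forall x, ifourier k x = ifourier g x * ifourier h x &
      wnorm k <= wnorm g * wnorm h].
Proof.
move=> ig ih; have [ic Nc] := conv_bound ig ih.
exists (fun t => c0%:C * conv g h t); split; first exact: cigZ.
  by move=> x; rewrite ifourierZ// /ifourier (cint_conv x ig ih); ring.
have E : wnorm (fun t => c0%:C * conv g h t) <= c0 * wnorm (conv g h).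
  have := wnormMb ic (cmeas_cst (c0%:C)) (fun=> lexx _).
  rewrite abs1_real ger0_norm ?c0_ge0//.
  apply: le_trans; rewrite le_eqVlt; apply/orP; left; apply/eqP.
  by congr (_ * _); apply: I_ext => t; rewrite mulrC.
apply: le_trans E _; rewrite /wnorm.
have -> : c0 * norm1 g * (c0 * norm1 h) = c0 * (c0 * (norm1 g * norm1 h)) by ring.
by rewrite !ler_wpM2l ?c0_ge0.
Qed.

Lemma ifourier_sum (u : nat -> R -> C) n x : (forall k, cintegrable (u k)) ->
  ifourier (fun t => \sum_(k < n) u k t) x = \sum_(k < n) ifourier (u k) x.
Proof.
move=> iu; elim: n => [|n IH].
  rewrite big_ord0 (_ : (fun t => _) = fun t => 0 * u 0%N t).
    by rewrite (ifourierZ _ _ (iu 0%N)) mul0r.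
  by apply/funext => t; rewrite big_ord0 mul0r.
rewrite big_ord_recr /= -IH -(ifourierD x (cig_sum n iu) (iu n)).
by rewrite (_ : (fun t => \sum_(k < n.+1) u k t) = fun t => \sum_(k < n) u k t + u n t)//;
  apply/funext => t; rewrite big_ord_recr.
Qed.

Lemma wiener_series (u : nat -> R -> C) (M : R) : (forall n, cintegrable (u n)) ->
  (forall n, \sum_(k < n) wnorm (u k) <= M) ->
  exists U : R -> C, cintegrable U /\
    wnorm (fun x => U x - \sum_(k < n) u k x) @[n --> \oo] --> (0 : R).
Proof.
move=> iu uM; have c00 : 0 < c0 by rewrite invr_gt0 mulr_gt0 ?pi_gt0.
have [|U [iU cU]] := @norm1_series R u (M / c0) iu.
  by move=> n; rewrite ler_pdivlMr// mulr_suml; have := uM n; under eq_bigr do rewrite /wnorm mulrC.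
exists U; split => //; rewrite -(mulr0 c0).
by apply: cvgM => //; exact: cvg_cst.
Qed.

Lemma cigB g h : cintegrable g -> cintegrable h -> cintegrable (fun t => g t - h t).
Proof.
move=> ig ih; have := cigD ig (cigZ (-1) ih).
by congr cintegrable; apply/funext => t; rewrite mulN1r.
Qed.

(* The bounds come from [(n+1)! >= 2^n]. *)
Lemma wiener_exp g : cintegrable g -> wnorm g <= 1 -> exists U,
  [/\ cintegrable U, forall x, ifourier U x = cexp (ifourier g x) - 1,
      wnorm U <= 2 * wnorm g & wnorm (fun t => U t - g t) <= wnorm g ^+ 2].
Proof.
move=> ig g1; set t := wnorm g; have t0 : 0 <= t := wnorm_ge0 g.
have P n : exists k, [/\ cintegrable k, forall x, ifourier k x = ifourier g x ^+ n.+1 &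
    wnorm k <= t ^+ n.+1].
  elim: n => [|n [k [ik kE kn]]]; first by exists g; split => // x; rewrite expr1.
  have [k' [ik' kE' kn']] := wiener_mul ig ik.
  exists k'; split => // [x|]; first by rewrite kE' kE [RHS]exprS.
  apply: le_trans kn' _; rewrite [t ^+ _]exprS; apply: ler_pM => //; exact: wnorm_ge0.
have [p Pp] := choice P.
have ip n : cintegrable (p n) by case: (Pp n).
(* A nonzero constant is not the inverse transform of an integrable function, so the series omits
   the term 1 and starts in degree one. Taking g itself as first term, instead of the chosen [p 0],
   makes [U - g] exactly the tail. *)
pose u n : R -> C := if n is 0 then g else fun s => (n.+1`!%:R^-1)%:C * p n s.
have iu n : cintegrable (u n) by case: n => [|n]; [exact: ig|exact: cigZ].
have uE n x : ifourier (u n) x = (n.+1`!%:R^-1)%:C * ifourier g x ^+ n.+1.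
  case: n => [|n]; first by rewrite (_ : 1`! = 1%N)// invr1 expr1 mul1r.
  by rewrite /u ifourierZ//; case: (Pp n.+1) => _ ->.
have fact2 n : (2 ^ n <= n.+1`!)%N.
  elim: n => // n IH; rewrite expnS factS; exact: leq_mul.
have uN n : wnorm (u n.+1) <= t ^+ 2 / 2 ^+ n.+1.
  have := wnormMb (ip n.+1) (cmeas_cst ((n.+2`!%:R^-1)%:C)) (fun=> lexx _).
  rewrite abs1_real ger0_norm ?invr_ge0//.
  rewrite (_ : (fun s => p n.+1 s * _) = u n.+1); last by apply/funext => s; rewrite mulrC.
  move=> h; apply: le_trans h _; rewrite mulrC; apply: ler_pM; rewrite ?wnorm_ge0 ?invr_ge0//.
    case: (Pp n.+1) => _ _ /le_trans; apply.
    by rewrite -addn2 exprD ler_piMl ?sqr_ge0// exprn_ile1.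
  by rewrite lef_pV2 ?posrE ?exprn_gt0 ?ltr0n ?fact_gt0// -natrX ler_nat.
have geo n : \sum_(k < n) t ^+ 2 / 2 ^+ k.+1 <= t ^+ 2 :> R.
  suff -> : \sum_(k < n) t ^+ 2 / 2 ^+ k.+1 = t ^+ 2 - t ^+ 2 / 2 ^+ n :> R.
    by rewrite lerBlDr lerDl mulr_ge0 ?sqr_ge0 ?invr_ge0 ?exprn_ge0.
  elim: n => [|n IH]; first by rewrite big_ord0 expr0 divr1 subrr.
  rewrite big_ord_recr /= IH (exprS 2 n); have : (2 ^+ n : R) != 0 by rewrite expf_neq0.
  by move=> h; field.
have uS n : \sum_(k < n) wnorm (u k.+1) <= t ^+ 2.
  by apply: le_trans (geo n); apply: ler_sum => k _; exact: uN.
have [U [iU cU]] : exists U : R -> C, cintegrable U /\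
    wnorm (fun x => U x - \sum_(k < n) u k x) @[n --> \oo] --> (0 : R).
  apply: (@wiener_series u (t + t ^+ 2)) => // -[|n].
    by rewrite big_ord0 addr_ge0 ?sqr_ge0.
  by rewrite big_ord_recl /= lerD2l; exact: uS.
(* [U - g] is a finite tail, of norm at most t^2, plus a remainder that tends to 0. *)
have nB n : wnorm (fun s => U s - g s) <= t ^+ 2 + wnorm (fun x => U x - \sum_(k < n.+1) u k x).
  rewrite (_ : (fun s => U s - g s) = fun s => (\sum_(k < n) u k.+1 s) +
    (U s - \sum_(k < n.+1) u k s)); last first.
    by apply/funext => s; rewrite big_ord_recl /=; ring.
  apply: le_trans (wnormD (cig_sum _ (fun k => iu k.+1)) (cigB iU (cig_sum _ iu))) _.
  rewrite lerD2r; apply: le_trans (uS n).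
  elim: n => [|n IH].
    rewrite big_ord0 /wnorm (_ : norm1 _ = 0) ?mulr0// /norm1 (I_ext (g := fun=> 0)).
      by rewrite /Rintegral integral0.
    by move=> s; rewrite big_ord0 /abs1 /= normr0 addr0.
  rewrite big_ord_recr /= (_ : (fun s => _) = fun s => (\sum_(k < n) u k.+1 s) + u n.+1 s).
    by apply: le_trans (wnormD (cig_sum _ (fun k => iu k.+1)) (iu n.+1)) _; rewrite lerD2r.
  by apply/funext => s; rewrite big_ord_recr.
have nUg : wnorm (fun s => U s - g s) <= t ^+ 2.
  have cU' : t ^+ 2 + wnorm (fun x => U x - \sum_(k < n.+1) u k x) @[n --> \oo] --> t ^+ 2.
    rewrite -[X in _ --> X]addr0; apply: cvgD; first exact: cvg_cst.
    by rewrite (cvg_shiftS (fun n => wnorm (fun x => U x - \sum_(k < n) u k x))).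
  by apply: (cvgr_to_ge cU'); exact: nearW.
exists U; split => //.
- move=> x; apply/eqP; rewrite -subr_eq0; apply/eqP; apply: abs1_eq0.
  (* Both sides are compared with one partial sum: the transform differs from it by at most twice
     the norm of the remainder, the exponential by a Taylor error. The n terms of [u] correspond to
     n + 1 terms of [exp_sum] because of the constant 1. *)
  have [K KE] := exp_sum_err (ifourier g x).
  have cv : 2 * wnorm (fun x => U x - \sum_(k < n) u k x) +
      K * exp_coeff (abs1 (ifourier g x)) n @[n --> \oo] --> (0 : R).
    rewrite (_ : 0 = 2 * 0 + K * 0 :> R); last by ring.
    apply: cvgD; apply: cvgM => //; try exact: cvg_cst.
    exact: cvg_exp_coeff.
  apply: (cvgr_to_ge cv); apply: nearW => n.
  have E : ifourier U x - (cexp (ifourier g x) - 1) =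
    ifourier (fun t => U t - \sum_(k < n) u k t) x +
    - (cexp (ifourier g x) - exp_sum (ifourier g x) n.+1).
    have -> : ifourier (fun t => U t - \sum_(k < n) u k t) x =
        ifourier U x - \sum_(k < n) ifourier (u k) x.
      have isn := cig_sum n iu.
      rewrite -(ifourier_sum n x iu) -mulN1r -(ifourierZ _ _ isn) -(ifourierD _ iU (cigZ _ isn)).
      rewrite (_ : (fun t => U t - _) = fun t => U t + -1 * \sum_(k < n) u k t)//.
      by apply/funext => s; rewrite mulN1r.
    have -> : exp_sum (ifourier g x) n.+1 = 1 + \sum_(k < n) ifourier (u k) x.
      rewrite /exp_sum big_ord_recl; congr (_ + _); first by rewrite /= fact0 invr1 expr0 mulr1.
      by apply: eq_bigr => i _; rewrite uE.
    by ring.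
  rewrite E; apply: le_trans (abs1D _ _) _; rewrite abs1N; apply: lerD => //.
  by apply: ifourier_abs1; exact/cigB/cig_sum.
- rewrite (_ : U = fun s => g s + (U s - g s)); last by apply/funext => s; ring.
  apply: le_trans (wnormD ig (cigB iU ig)) _.
  rewrite -/t; have : t ^+ 2 <= t by rewrite expr2 ler_piMl.
  by move: nUg; lra.
Qed.

End WienerAlgebra.

(** * The fixed point *)

Section FixedPoint.
Context {R : realType}.
Local Notation C := R[i].
Implicit Types g h psi delta : R -> C.

Lemma wnormZ (z : C) g : cintegrable g -> wnorm (fun t => z * g t) <= abs1 z * wnorm g.
Proof.
move=> ig; have := wnormMb ig (cmeas_cst z) (fun=> lexx _).
by rewrite (_ : (fun t => g t * z) = fun t => z * g t)//; apply/funext => t; rewrite mulrC.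
Qed.

Lemma wnorm0 : wnorm (fun=> 0 : C) = 0.
Proof. by rewrite /wnorm /norm1 /abs1 /= normr0 addr0 /Rintegral integral0 mulr0. Qed.

Lemma ifourier0 x : ifourier (fun=> 0 : C) x = 0.
Proof. by apply: abs1_eq0; apply: le_trans (ifourier_abs1 x cig0) _; rewrite wnorm0 mulr0. Qed.

Section Multiplier.
Context (lam : R) (w : R -> R).
Context (lam0 : 0 < lam).
Context (mw : measurable_fun setT w).
Context (w_le : forall t, `|w t| <= (2 * lam ^+ 2)^-1).
Context (tw_le : forall t, `|t * w t| <= lam^-1).

Definition multw psi (t : R) : C := psi t * (w t)%:C.

Let cmeas_w : cmeas (fun t => (w t)%:C).
Proof. by split => //; exact: measurable_cst. Qed.

Let cmeas_tw : cmeas (fun t => 0 +i* (t * w t)).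
Proof. by split; [exact: measurable_cst|exact: measurable_funM]. Qed.

Lemma cig_multw psi : cintegrable psi -> cintegrable (multw psi).
Proof. by move=> ip; apply: cigMb cmeas_w _ => // t; rewrite abs1_real. Qed.

Lemma wnorm_multw psi : cintegrable psi -> wnorm (multw psi) <= (2 * lam ^+ 2)^-1 * wnorm psi.
Proof. by move=> ip; apply: wnormMb cmeas_w _ => // t; rewrite abs1_real. Qed.

Lemma multw_deriv psi : (fun t => multw psi t * (0 +i* t)) = fun t => psi t * (0 +i* (t * w t)).
Proof.
apply/funext => t; rewrite /multw; case: (psi t) => a b.
by apply/eqP; rewrite eq_complex /=; apply/andP; split; apply/eqP; ring.
Qed.

Let abs1_tw t : abs1 (0 +i* (t * w t)) <= lam^-1.
Proof. by rewrite /abs1 /= normr0 add0r. Qed.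

Lemma cig_multw_deriv psi : cintegrable psi -> cintegrable (fun t => multw psi t * (0 +i* t)).
Proof. by move=> ip; rewrite multw_deriv; exact: cigMb cmeas_tw abs1_tw. Qed.

Lemma wnorm_multw_deriv psi : cintegrable psi ->
  wnorm (fun t => multw psi t * (0 +i* t)) <= lam^-1 * wnorm psi.
Proof. by move=> ip; rewrite multw_deriv; exact: wnormMb cmeas_tw abs1_tw. Qed.

Lemma SopE psi x : cintegrable psi -> Sop lam (ifourier (multw psi)) x =
  (4^-1)%:C * ifourier (fun t => multw psi t * (0 +i* t)) x ^+ 2 -
  (4 * lam ^+ 2)%:C * (cexp (ifourier (multw psi) x) - 1 - ifourier (multw psi) x).
Proof.
by move=> ip; rewrite /Sop ifourier_derive//; [exact: cig_multw|exact: cig_multw_deriv].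
Qed.

Let Sop_algebra (a k f d f1 d1 ef ed : C) :
  a * (d1 * (2 * f1 + d1)) + - k * ((ef - 1) * (ed - 1) + (ed - 1 - d)) =
  a * (f1 + d1) ^+ 2 - k * (ef * ed - 1 - (f + d)) - (a * f1 ^+ 2 - k * (ef - 1 - f)).
Proof. by ring. Qed.

(* With f, d the transforms of psi, delta after multiplication by w, the increment of S is
   d'(2f' + d')/4 - 4 lam^2 ((e^f - 1)(e^d - 1) + (e^d - 1 - d)). *)
Lemma Sop_increment psi delta : cintegrable psi -> cintegrable delta ->
  wnorm psi <= lam ^+ 2 / 18 -> wnorm delta <= lam ^+ 2 / 18 ->
  exists d, [/\ cintegrable d,
    forall x, ifourier d x = Sop lam (ifourier (multw (fun t => psi t + delta t))) x
      - Sop lam (ifourier (multw psi)) x &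
    wnorm d <= 2^-1 * wnorm delta].
Proof.
move=> ip id np nd.
have l2 : 0 < lam ^+ 2 by rewrite exprn_gt0.
have it := cig_multw ip; have is_ := cig_multw id.
have it1 := cig_multw_deriv ip; have is1 := cig_multw_deriv id.
set t := wnorm (multw psi); set s := wnorm (multw delta).
have t0 : 0 <= t := wnorm_ge0 _; have s0 : 0 <= s := wnorm_ge0 _.
have d0 : 0 <= wnorm delta := wnorm_ge0 _; have p0 : 0 <= wnorm psi := wnorm_ge0 _.
(* After multiplication by [w] both arguments have norm at most 1/36, well inside the unit ball
   where [wiener_exp] applies. *)
have E36 : (2 * lam ^+ 2)^-1 * (lam ^+ 2 / 18) = 36^-1 by field; rewrite gt_eqF.
have tle : t <= 36^-1.
  by rewrite -E36; apply: le_trans (wnorm_multw ip) _; rewrite ler_wpM2l// invr_ge0 mulr_ge0// ltW.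
have sle' : s <= (2 * lam ^+ 2)^-1 * wnorm delta := wnorm_multw id.
have sle : s <= 36^-1.
  by rewrite -E36; apply: le_trans sle' _; rewrite ler_wpM2l// invr_ge0 mulr_ge0// ltW.
have q1 : 4 * t * s <= 4 / 36 * s by apply: ler_wpM2r => //; lra.
have q2 : s ^+ 2 <= 1 / 36 * s by rewrite expr2; apply: ler_wpM2r => //; lra.
have [|U [iU UE UN _]] := wiener_exp it; first by rewrite -/t; lra.
have [|V [iV VE VN VN2]] := wiener_exp is_; first by rewrite -/s; lra.
rewrite -/t in UN; rewrite -/s in VN VN2.
have iV' := cigB iV is_.
pose g2 x := 2 * (multw psi x * (0 +i* x)) + multw delta x * (0 +i* x).
have ig2 : cintegrable g2 by exact/cigD/is1/cigZ.
have [A [iA AE AN]] := wiener_mul is1 ig2.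
have [B [iB BE BN]] := wiener_mul iU iV.
have iBV := cigD iB iV'.
exists (fun x => (4^-1)%:C * A x + (- (4 * lam ^+ 2))%:C * (B x + (V x - multw delta x))).
have iA4 := cigZ ((4^-1)%:C) iA.
have iBV4 := cigZ ((- (4 * lam ^+ 2))%:C) iBV.
split; first exact: cigD.
  move=> x; rewrite ifourierD// !ifourierZ// ifourierD// AE BE UE VE.
  have -> : ifourier g2 x = 2 * ifourier (fun t => multw psi t * (0 +i* t)) x
      + ifourier (fun t => multw delta t * (0 +i* t)) x.
    by rewrite ifourierD ?ifourierZ//; exact: cigZ.
  have -> : ifourier (fun x => V x - multw delta x) x = ifourier V x - ifourier (multw delta) x.
    rewrite -(mulN1r (ifourier (multw delta) x)) -(ifourierZ _ _ is_) -(ifourierD _ iV (cigZ _ is_)).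
    rewrite (_ : (fun x => V x - _) = fun x => V x + -1 * multw delta x)//.
    by apply/funext => y; rewrite mulN1r.
  rewrite VE !SopE//; last exact: cigD.
  have -> : ifourier (fun t => multw (fun t => psi t + delta t) t * (0 +i* t)) x =
     ifourier (fun t => multw psi t * (0 +i* t)) x + ifourier (fun t => multw delta t * (0 +i* t)) x.
    rewrite -(ifourierD _ it1 is1).
    rewrite (_ : (fun t => multw (fun t => _) t * _) =
      fun t => multw psi t * (0 +i* t) + multw delta t * (0 +i* t))//.
    by apply/funext => y; rewrite /multw !mulrDl.
  have -> : ifourier (multw (fun t => psi t + delta t)) x =
     ifourier (multw psi) x + ifourier (multw delta) x.
    rewrite -(ifourierD _ it is_).
    rewrite (_ : multw (fun t => _) = fun t => multw psi t + multw delta t)//.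
    by apply/funext => y; rewrite /multw mulrDl.
  rewrite cexpD (rmorphN (real_complex R)); exact: Sop_algebra.
apply: le_trans (wnormD iA4 iBV4) _.
have b1 := wnormZ ((4^-1)%:C) iA; have b2 := wnormZ ((- (4 * lam ^+ 2))%:C) iBV.
rewrite abs1_real ger0_norm ?invr_ge0// in b1.
rewrite abs1_real normrN ger0_norm ?mulr_ge0 ?(ltW l2) ?(ltW lam0)// in b2.
have b3 := wnormD iB iV'.
have b4 : wnorm g2 <= lam^-1 * (3 * (lam ^+ 2 / 18)).
  have h1 := wnormD (cigZ 2 it1) is1.
  have h2 := wnormZ 2 it1; have h3 := wnorm_multw_deriv ip; have h4 := wnorm_multw_deriv id.
  have n2 : abs1 (2 : C) = 2 by rewrite /abs1 /= !addr0 normr0 addr0 ger0_norm.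
  rewrite n2 in h2.
  have h5 : lam^-1 * wnorm psi <= lam^-1 * (lam ^+ 2 / 18) by rewrite ler_wpM2l// invr_ge0 ltW.
  have h6 : lam^-1 * wnorm delta <= lam^-1 * (lam ^+ 2 / 18) by rewrite ler_wpM2l// invr_ge0 ltW.
  clear -h1 h2 h3 h4 h5 h6; lra.
have b5 := wnorm_multw_deriv id.
have b6 : wnorm A <= wnorm delta / 6.
  apply: le_trans AN _.
  have -> : wnorm delta / 6 = (lam^-1 * wnorm delta) * (lam^-1 * (3 * (lam ^+ 2 / 18))).
    by field; rewrite gt_eqF.
  by apply: ler_pM => //; exact: wnorm_ge0.
have b7 : wnorm B <= 4 * t * s.
  apply: le_trans BN _; have -> : 4 * t * s = 2 * t * (2 * s) by ring.
  by apply: ler_pM => //; exact: wnorm_ge0.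
have b8 : wnorm (fun x => B x + (V x - multw delta x)) <= 5 / 36 * s.
  apply: le_trans b3 _; apply: le_trans (lerD b7 VN2) _.
  by apply: le_trans (lerD q1 q2) _; rewrite -mulrDl; apply: ler_wpM2r => //; lra.
have b9 : 4 * lam ^+ 2 * s <= 2 * wnorm delta.
  have -> : 2 * wnorm delta = 4 * lam ^+ 2 * ((2 * lam ^+ 2)^-1 * wnorm delta).
    by field; rewrite gt_eqF.
  by rewrite ler_wpM2l// mulr_ge0// ltW.
have b10 : 4 * lam ^+ 2 * wnorm (fun x => B x + (V x - multw delta x)) <= 4 * lam ^+ 2 * (5 / 36 * s).
  by rewrite ler_wpM2l// mulr_ge0// ltW.
(* The quadratic term contributes 1/4 * 1/6, the exponential term 5/36 * 2 since 4 lam^2 s is at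
   most twice the norm of [delta]; together 23/72, below 1/2. *)
apply: le_trans (lerD b1 (le_trans b2 b10)) _.
lra.
Qed.

Lemma Sop0 x : Sop lam (ifourier (multw (fun=> 0 : C))) x = 0.
Proof.
rewrite (SopE _ cig0).
have E1 : multw (fun=> 0 : C) = fun=> 0 by apply/funext => t; rewrite /multw mul0r.
rewrite E1 (_ : (fun t => 0 * _) = fun=> 0); last by apply/funext => t; rewrite mul0r.
by rewrite !ifourier0 cexp0 subrr subr0 expr0n /= !mulr0 subr0.
Qed.

(** The increments are bounded by r, r/2, r/4, ..., whose sum 2r = lam^2/18 is exactly the radius up
    to which [Sop_increment] is available. *)
Lemma wiener_fixpoint q : cintegrable q -> wnorm q <= lam ^+ 2 / 36 ->
  exists psi, cintegrable psi /\
    forall x, ifourier psi x = Sop lam (ifourier (multw psi)) x + ifourier q x.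
Proof.
move=> iq nq; set r := lam ^+ 2 / 36 in nq.
have l2 : 0 < lam ^+ 2 by rewrite exprn_gt0.
have r0 : 0 < r by rewrite divr_gt0.
have r2 : lam ^+ 2 / 18 = 2 * r by rewrite /r; field.
(* The conditions sit inside the existential so that [choice] returns a total map [F] that can be
   iterated; they are then verified along the orbit. *)
have exF (pd : (R -> C) * (R -> C)) : exists d' : R -> C,
    cintegrable pd.1 -> cintegrable pd.2 -> wnorm pd.1 <= 2 * r -> wnorm pd.2 <= 2 * r ->
    [/\ cintegrable d',
    forall x, ifourier d' x = Sop lam (ifourier (multw (fun t => pd.1 t + pd.2 t))) x
      - Sop lam (ifourier (multw pd.1)) x &
    wnorm d' <= 2^-1 * wnorm pd.2].
  case: pd => p d /=.
  have [[i1 i2 n1_ n2_]|no] := pselect [/\ cintegrable p, cintegrable d, wnorm p <= 2 * r & wnorm d <= 2 * r].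
    rewrite -r2 in n1_ n2_.
    by have [d' ?] := Sop_increment i1 i2 n1_ n2_; exists d'.
  by exists (fun=> 0) => *; exfalso; apply: no.
have [F FP] := choice exF.
(* A state is the current iterate together with the increment still to be added. It starts at (0, q)
   because S vanishes at 0. *)
pose st n := iter n (fun pd => ((fun t => pd.1 t + pd.2 t), F pd)) ((fun=> 0 : C), q).
have stS n : st n.+1 = ((fun t => (st n).1 t + (st n).2 t), F (st n)) by [].
pose e n := r / 2 ^+ n.
have e0 n : 0 < e n by rewrite divr_gt0// exprn_gt0.
have eS n : e n.+1 = 2^-1 * e n.
  by rewrite /e exprS; have : (2 ^+ n : R) != 0 by [rewrite expf_neq0]; move=> h; field.
(* The room left below the radius 2r is 2 e_n; adding an increment of size at most e_n leaves e_n =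
   2 e_(n+1), so the bound reproduces itself. The last clause says that the next iterate is S of the
   current one plus q. *)
have inv n : [/\ cintegrable (st n).1, cintegrable (st n).2,
    wnorm (st n).1 <= 2 * r - 2 * e n, wnorm (st n).2 <= e n &
    forall x, ifourier (st n).1 x + ifourier (st n).2 x =
      Sop lam (ifourier (multw (st n).1)) x + ifourier q x].
  elim: n => [|n [i1 i2 b1 b2 E]].
    split => //=; rewrite ?wnorm0 /e ?expr0 ?divr1 ?subrr//; first exact: cig0.
    by move=> x; rewrite Sop0 ifourier0.
  have en := e0 n.
  have er : e n <= r.
    by rewrite /e ler_pdivrMr ?exprn_gt0// -[leLHS]mulr1 ler_wpM2l ?(ltW r0)// exprn_ege1// ler1n.
  have [|||| iF FE Fn] := FP (st n) => //; [lra|lra|].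
  rewrite stS /=; split => //; first exact: cigD.
  - by apply: le_trans (wnormD i1 i2) _; rewrite eS; lra.
  - by rewrite eS; apply: le_trans Fn _; rewrite ler_wpM2l.
  - by move=> x; rewrite ifourierD// FE E; ring.
have sE n t : (st n).1 t = \sum_(k < n) (st k).2 t.
  elim: n => [|n IH]; first by rewrite big_ord0.
  by rewrite big_ord_recr /= -IH.
have [U [iU cU]] : exists U : R -> C, cintegrable U /\
    wnorm (fun x => U x - \sum_(k < n) (st k).2 x) @[n --> \oo] --> (0 : R).
  apply: (@wiener_series R (fun k => (st k).2) (2 * r)) => n; first by case: (inv n).
  apply: (@le_trans _ _ (\sum_(k < n) e k)).
    by apply: ler_sum => k _; case: (inv k).
  suff -> : \sum_(k < n) e k = 2 * r - 2 * e n by rewrite lerBlDr lerDl mulr_ge0// ltW.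
  elim: n => [|n IH]; first by rewrite big_ord0 /e expr0 divr1 subrr.
  by rewrite big_ord_recr /= IH eS; field.
pose rho n := wnorm (fun x => U x - (st n).1 x).
have crho : rho n @[n --> \oo] --> (0 : R).
  apply: cvg_trans cU; apply: near_eq_cvg; apply: nearW => n.
  by rewrite /rho; congr wnorm; apply/funext => t; rewrite sE.
(* Passing to the limit needs no continuity of S: apply [Sop_increment] to the error term. *)
exists U; split => // x.
apply/eqP; rewrite -subr_eq0; apply/eqP; apply: abs1_eq0.
(* The defect of U is split into U minus the iterate n + 1, of size at most 2 rho (n+1), and the
   increment of S from iterate n to U, of size at most 2 * 1/2 * rho n. *)
have cv : 2 * rho n.+1 + rho n @[n --> \oo] --> (0 : R).
  rewrite (_ : 0 = 2 * 0 + 0 :> R); last by ring.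
  apply: cvgD => //; apply: cvgM; first exact: cvg_cst.
  by rewrite (cvg_shiftS rho).
apply: (cvgr_to_ge cv); near=> n.
(* Once the error is below 2r = lam^2/18 it is admissible as the increment in [Sop_increment]. *)
have rn : rho n <= 2 * r.
  apply: ltW; near: n; apply: (cvgr_lt _ crho); lra.
have [i1 i2 b1 b2 E] := inv n.
have iUn := cigB iU i1.
have en := e0 n.
have [|| d [idd dE dn]] := Sop_increment i1 iUn; rewrite ?r2//; first lra.
have EU : (fun t => (st n).1 t + (U t - (st n).1 t)) = U by apply/funext => t; ring.
rewrite EU in dE.
have EE : ifourier U x - (Sop lam (ifourier (multw U)) x + ifourier q x) =
  ifourier (fun t => U t - (st n.+1).1 t) x + - ifourier d x.
  have -> : ifourier (fun t => U t - (st n.+1).1 t) x = ifourier U x - ifourier (st n.+1).1 x.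
    have [j1 _ _ _ _] := inv n.+1.
    rewrite -(mulN1r (ifourier (st n.+1).1 x)) -(ifourierZ _ _ j1) -(ifourierD _ iU (cigZ _ j1)).
    rewrite (_ : (fun x => U x - _) = fun x => U x + -1 * (st n.+1).1 x)//.
    by apply/funext => y; rewrite mulN1r.
  have alg (a b c z : C) : a - (b + z) = a - (c + z) + - (b - c) by ring.
  by rewrite stS ifourierD// E dE; exact: alg.
rewrite EE; apply: le_trans (abs1D _ _) _; rewrite abs1N.
have [j1 _ _ _ _] := inv n.+1.
apply: lerD; first exact: (ifourier_abs1 x (cigB iU j1)).
apply: le_trans (ifourier_abs1 x idd) _.
by rewrite -/(rho n) in dn; lra.
Unshelve. all: end_near. Qed.

End Multiplier.
End FixedPoint.

(** * The fundamental theorem of calculus on the line *)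

Section FundamentalTheoremOnLine.
Context {R : realType}.
Local Notation C := R[i].
Local Notation mu := (@lebesgue_measure R).
Local Notation intg f := (mu.-integrable setT (EFin \o f)).
Local Notation I f := (Rintegral mu setT f).

Lemma Rintegral_indic (D : set R) (f : R -> R) :
  Rintegral mu D f = I (fun x => \1_D x * f x).
Proof.
rewrite Rintegral_mkcond; apply: I_ext => x; rewrite patchE indicE.
by case: ifP => _; rewrite ?mul1r ?mul0r.
Qed.

Lemma meas_indic (D : set R) : measurable D -> measurable_fun setT (\1_D : R -> R).
Proof. by move=> mD; exact: measurable_indic. Qed.

Lemma indic_le1 (D : set R) x : `|\1_D x : R| <= 1.
Proof. by rewrite indicE; case: (_ \in _); rewrite ?normr1 ?normr0. Qed.

Lemma ae_neq (a : R) : {ae mu, forall x, x != a}.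
Proof.
exists [set a]; split; [exact: measurable_set1|exact: lebesgue_measure_set1|].
by move=> x /= /negP; rewrite negbK => /eqP.
Qed.

Lemma is_derive_cont (f F : R -> R) : (forall x : R, is_derive x 1 F (f x)) -> continuous F.
Proof. by move=> h x; apply: derivable_continuous; case: (h x). Qed.

Lemma Rintegral_FTC (f F : R -> R) (a b : R) : a < b -> continuous f ->
  (forall x : R, is_derive x 1 F (f x)) -> Rintegral mu `[a, b] f = F b - F a.
Proof.
move=> ab cf dF; rewrite /Rintegral (@continuous_FTC2 _ f F a b ab)//.
- exact: continuous_subspaceT.
- have cF := is_derive_cont dF.
  split; first by move=> x _; case: (dF x).
  + by apply: cvg_at_right_filter; exact: cF.
  + by apply: cvg_at_left_filter; exact: cF.
- by move=> x _; rewrite derive1E; case: (dF x).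
Qed.

(* Two antiderivatives are allowed because [expR (- (k * `|t|))] is not differentiable at 0. *)
Lemma I_FTC (f fp fm Fp Fm : R -> R) (lp lm : R) :
  intg f -> continuous fp -> continuous fm ->
  (forall x : R, is_derive x 1 Fp (fp x)) -> (forall x : R, is_derive x 1 Fm (fm x)) ->
  (forall x, 0 <= x -> f x = fp x) -> (forall x, x <= 0 -> f x = fm x) ->
  Fp n.+1%:R @[n --> \oo] --> lp -> Fm (- n.+1%:R) @[n --> \oo] --> lm ->
  I f = (lp - Fp 0) + (Fm 0 - lm).
Proof.
move=> fi cfp cfm dp dm fE1 fE2 Llp Llm.
pose f_ (n : nat) x := \1_(`[0, n.+1%:R]) x * f x + \1_(`[- n.+1%:R, 0]) x * f x.
have mf := intg_meas fi.
have mi (a b : R) : measurable_fun setT (\1_(`[a, b]) : R -> R) by exact: meas_indic.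
have iI (a b : R) : intg (fun x => \1_(`[a, b]) x * f x).
  apply: (intg_le _ _ (intg_norm fi)); first exact: measurable_funM.
  by move=> x; rewrite normrM ler_piMl ?indic_le1.
have [||||| _ cv] := @I_dct R f_ f (fun x => `|f x| + `|f x|).
- by move=> n; apply: measurable_funD; apply: measurable_funM.
- exact: mf.
(* At 0 both indicators equal 1 and [f_] takes the value 2 f(0) there; this single point is
   discarded as a null set. *)
- apply: ae_imp (ae_neq 0) _ => x x0.
  apply: cvg_near_cst; near=> n.
  have nx : `|x| <= n.+1%:R by near: n; exists (Num.trunc `|x|) => // m /= mx;
    apply: (le_trans (ltW (truncnS_gt _))); rewrite ler_nat ltnS.
  rewrite /f_ !indicE.
  move: nx; rewrite ler_norml => /andP[nx1 nx2].
  have [xp|xn|xe] := ltgtP x 0; last by rewrite xe eqxx in x0.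
    rewrite memNset; last by rewrite /= in_itv /= leNgt xp.
    rewrite mem_set; last by rewrite /= in_itv /= nx1 ltW.
    by rewrite mul0r add0r mul1r.
  rewrite mem_set; last by rewrite /= in_itv /= nx2 ltW.
  rewrite memNset; last by rewrite /= in_itv /= (leNgt x) xn andbF.
  by rewrite mul0r addr0 mul1r.
- by apply: intgD; exact: intg_norm.
- move=> n x; apply: le_trans (ler_normD _ _) _; rewrite !normrM.
  by apply: lerD; rewrite ler_piMl ?indic_le1.
have E n : I (f_ n) = (Fp n.+1%:R - Fp 0) + (Fm 0 - Fm (- n.+1%:R)).
  rewrite ID// -!Rintegral_indic; congr (_ + _).
    rewrite -(Rintegral_FTC _ cfp dp)//; apply: eq_Rintegral => x.
    by rewrite inE /= in_itv /= => /andP[x0 _]; exact: fE1.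
  rewrite -(Rintegral_FTC _ cfm dm) ?oppr_lt0//; apply: eq_Rintegral => x.
  by rewrite inE /= in_itv /= => /andP[_ x0]; exact: fE2.
apply: (cvg_unique (@Rhausdorff R) cv).
rewrite (_ : (fun n => I (f_ n)) = fun n => (Fp n.+1%:R - Fp 0) + (Fm 0 - Fm (- n.+1%:R))).
  by apply: cvgD; apply: cvgB => //; exact: cvg_cst.
by apply/funext => n; rewrite E.
Unshelve. all: end_near. Qed.

Lemma intg_oneDsqrV : intg (fun x : R => (1 + x ^+ 2)^-1).
Proof.
apply: intg_ge0P.
- by apply: cont_meas; exact: continuous_oneDsqrV.
- by move=> x; rewrite invr_ge0 (le_trans ler01) ?(oneDsqr_ge1 x).
rewrite (@ge0_symfun_integralT R (fun x => (1 + x ^+ 2)^-1)).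
- rewrite (_ : [set x : R | _] = `[0, +oo[%classic).
    by have -> := integral0y_oneDsqr R; rewrite -EFinM ltry.
  by apply/seteqP; split => x /=; rewrite in_itv /= andbT.
- by move=> x; rewrite invr_ge0 (le_trans ler01) ?(oneDsqr_ge1 x).
- exact: continuous_oneDsqrV.
- by move=> x /=; rewrite sqrrN.
Qed.

(** From e^s >= 1 + s^2/2 with s = k|t|. The majorant is chosen because its integrability is known
    from the arctangent integral. *)
Lemma exp_abs_le (k t : R) : 0 < k -> expR (- (k * `|t|)) <= (2 / k ^+ 2 + 1) * (1 + t ^+ 2)^-1.
Proof.
move=> k0; have kt : 0 <= k * `|t| by rewrite mulr_ge0// ltW.
have e1 : 1 + (k * `|t|) ^+ 2 / 2 <= expR (k * `|t|) := expR_ge1Dxn 1 kt.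
rewrite expRN ler_pdivlMr; last by rewrite ltr_pwDl ?sqr_ge0.
rewrite mulrC ler_pdivrMr ?expR_gt0//.
apply: (@le_trans _ _ ((2 / k ^+ 2 + 1) * (1 + (k * `|t|) ^+ 2 / 2))); last first.
  by rewrite ler_wpM2l// addr_ge0// divr_ge0// sqr_ge0.
rewrite exprMn real_normK ?num_real// -subr_ge0.
have -> : (2 / k ^+ 2 + 1) * (1 + k ^+ 2 * t ^+ 2 / 2) - (1 + t ^+ 2) =
  2 / k ^+ 2 + k ^+ 2 * t ^+ 2 / 2 by field; rewrite gt_eqF.
have h1 := sqr_ge0 k; have h2 := sqr_ge0 t.
by apply: addr_ge0; [exact: divr_ge0|apply: divr_ge0 => //; exact: mulr_ge0].
Qed.

Lemma cont_exp_abs (k : R) : continuous (fun t : R => expR (- (k * `|t|))).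
Proof.
move=> t; apply: (continuous_comp (f := fun t => - (k * `|t|)) (g := expR)); last exact: continuous_expR.
apply: cvgN; apply: cvgM; first exact: cvg_cst.
exact: norm_continuous.
Qed.

Lemma intg_exp_abs (k : R) : 0 < k -> intg (fun t => expR (- (k * `|t|))).
Proof.
move=> k0; apply: (intg_le _ _ (intgZ (2 / k ^+ 2 + 1) intg_oneDsqrV)).
  by apply: cont_meas; exact: cont_exp_abs.
by move=> t; rewrite ger0_norm ?expR_ge0//; exact: exp_abs_le.
Qed.

(** For fixed s and y this family is closed under differentiation, so finding an antiderivative
    inside it is a 2x2 linear system for the coefficients (A, B). *)
Definition exp_trig (s A B y t : R) : R := expR (s * t) * (A * sin (y * t) + B * cos (y * t)).

Lemma is_derive_exp_trig (s A B y t : R) : is_derive t 1 (exp_trig s A B y)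
  (exp_trig s (s * A - y * B) (s * B + y * A) y t).
Proof.
have l k := is_derive_mull k t.
have de := is_derive1_comp (g := fun t : R => s * t) (is_derive_expR (s * t)) (l s).
have dc := is_derive1_comp (g := fun t : R => y * t) (is_derive_cos (y * t)) (l y).
have ds := is_derive1_comp (g := fun t : R => y * t) (is_derive_sin (y * t)) (l y).
apply: (is_derive_eq (is_deriveM de (is_deriveD (is_deriveM (is_derive_cst A t 1) ds)
  (is_deriveM (is_derive_cst B t 1) dc)))).
rewrite /GRing.scale /exp_trig /= ?fctE /=; ring.
Qed.

Lemma exp_trig_cont (s A B y : R) : continuous (exp_trig s A B y).
Proof. exact: (is_derive_cont (is_derive_exp_trig s A B y)). Qed.

(** The sign e = 1 or -1 lets one statement cover decay along both half-lines. *)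
Lemma exp_trig_cvg0 (k A B y e : R) : 0 < k -> `|e| = 1 ->
  exp_trig (- (k * e)) A B y (e * n.+1%:R) @[n --> \oo] --> (0 : R).
Proof.
move=> k0 e1.
have ek : expR (- k) < 1 by rewrite expR_lt1 oppr_lt0.
have cv : (`|A| + `|B|) * expR (- k) ^+ n.+1 @[n --> \oo] --> (0 : R).
  rewrite -[X in _ --> X](mulr0 (`|A| + `|B|)); apply: cvgM; first exact: cvg_cst.
  rewrite (cvg_shiftS (fun n => expR (- k) ^+ n)).
  by apply: cvg_expr; rewrite ger0_norm ?expR_ge0.
apply/norm_cvg0P; apply: (squeeze_cvgr _ (@cvg_cst _ 0 _ _ _) cv).
apply: nearW => n; rewrite normr_ge0 /= /exp_trig normrM mulrC.
have -> : - (k * e) * (e * n.+1%:R) = - k * n.+1%:R.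
  have ee : e * e = 1 by rewrite -expr2 -real_normK ?num_real// e1 expr1n.
  by rewrite mulNr mulrA -(mulrA k) ee mulr1 mulNr.
rewrite expRM_natr (ger0_norm (exprn_ge0 _ (expR_ge0 _))).
apply: ler_wpM2r; first by rewrite exprn_ge0 ?expR_ge0.
apply: le_trans (ler_normD _ _) _; rewrite !normrM.
by apply: lerD; rewrite ler_piMr ?sin_le1n ?cos_le1n.
Qed.

(** The four equations say that (A, B) and (A', B') give antiderivatives on the positive and on the
    negative half-line. The boundary terms at infinity vanish and those at 0 leave B' - B. *)
Lemma I_exp_trig (k A B A' B' y a b : R) : 0 < k ->
  - k * A - y * B = a -> - k * B + y * A = b ->
  k * A' - y * B' = a -> k * B' + y * A' = b ->
  I (fun t => expR (- (k * `|t|)) * (a * sin (y * t) + b * cos (y * t))) = B' - B.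
Proof.
move=> k0 e1 e2 e3 e4.
transitivity ((0 - exp_trig (- k) A B y 0) + (exp_trig k A' B' y 0 - 0)); last first.
  by rewrite /exp_trig !mulr0 expR0 sin0 cos0; ring.
apply: (@I_FTC _ (exp_trig (- k) a b y) (exp_trig k a b y)).
- apply: (@intg_le _ _ (fun t => (`|a| + `|b|) * expR (- (k * `|t|)))).
  + apply: measurable_funM; first by apply: cont_meas; exact: cont_exp_abs.
    have [mc ms] := cmeas_eix y.
    by apply: measurable_funD; apply: measurable_funM => //; exact: measurable_cst.
  + move=> t; rewrite normrM mulrC (ger0_norm (expR_ge0 _)) ler_wpM2r ?expR_ge0//.
    apply: le_trans (ler_normD _ _) _; rewrite !normrM.
    by apply: lerD; rewrite ler_piMr ?sin_le1n ?cos_le1n.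
  + exact/intgZ/intg_exp_abs.
- exact: exp_trig_cont.
- exact: exp_trig_cont.
- by move=> t; have := is_derive_exp_trig (- k) A B y t; rewrite e1 e2.
- by move=> t; have := is_derive_exp_trig k A' B' y t; rewrite e3 e4.
- by move=> t t0; rewrite /exp_trig ger0_norm// mulNr.
- by move=> t t0; rewrite /exp_trig ler0_norm// mulrN opprK.
- have := @exp_trig_cvg0 k A B y 1 k0 (normr1 _); rewrite mulr1.
  by under eq_fun do rewrite mul1r.
- have := @exp_trig_cvg0 k A' B' y (-1) k0; rewrite normrN normr1 => /(_ erefl).
  by rewrite mulrN1 opprK; under eq_fun do rewrite mulN1r.
Qed.

Lemma cint_poisson (k y : R) : 0 < k ->
  cint (fun t => (expR (- (k * `|t|)))%:C * eix (y * t)) = (2 * k / (k ^+ 2 + y ^+ 2))%:C.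
Proof.
move=> k0; set D := k ^+ 2 + y ^+ 2.
have D0 : D != 0 by rewrite gt_eqF// ltr_pwDl ?sqr_ge0 ?exprn_gt0.
rewrite /cint; congr (_ +i* _).
  transitivity (I (fun t => expR (- (k * `|t|)) * (0 * sin (y * t) + 1 * cos (y * t)))).
    by apply: I_ext => t; rewrite /reF /=; ring.
  have -> : 2 * k / D = k / D - (- k / D) by field.
  by apply: (@I_exp_trig k (y / D) (- k / D) (y / D) (k / D)) => //; rewrite /D in D0 *; field.
transitivity (I (fun t => expR (- (k * `|t|)) * (1 * sin (y * t) + 0 * cos (y * t)))).
  by apply: I_ext => t; rewrite /imF /=; ring.
rewrite -(subrr (- y / D)).
by apply: (@I_exp_trig k (- k / D) (- y / D) (k / D) (- y / D)) => //; rewrite /D in D0 *; field.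
Qed.

End FundamentalTheoremOnLine.

(** * Fourier inversion *)

Section FourierInversion.
Context {R : realType}.
Local Notation C := R[i].
Local Notation mu := (@lebesgue_measure R).
Local Notation intg f := (mu.-integrable setT (EFin \o f)).
Local Notation I f := (Rintegral mu setT f).

Lemma integrable_itv_continuous (v : R -> R) a b : continuous v -> mu.-integrable `[a, b] (EFin \o v).
Proof.
move=> cv; apply: continuous_compact_integrable; first exact: segment_compact.
exact: continuous_subspaceT.
Qed.

Section IntervalUniqueness.
Context (u v : R -> R).
Context (iu : intg u).
Context (cv : continuous v).
Context (uv : forall a b, a < b -> Rintegral mu `[a, b] u = Rintegral mu `[a, b] v).

Let Fuv a : (fun x => Rintegral mu `[a, x] u) = (fun x => Rintegral mu `[a, x] v).
Proof.
apply/funext => x; have [ax|xa] := ltP a x; first exact: uv.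
move: xa; rewrite le_eqVlt => /predU1P[->|xa]; first by rewrite set_itv1 !Rintegral_set1.
by rewrite set_itv_ge ?Rintegral_set0// bnd_simp -ltNge.
Qed.

Let iuS a b : mu.-integrable `[a, b] (EFin \o u).
Proof. exact: (integrableS measurableT). Qed.

Let dv (a x : R) : a < x -> derivable (fun y : R => Rintegral mu `[a, y] v) x 1 /\
  derive1 (fun y : R => Rintegral mu `[a, y] v) x = v x.
Proof.
move=> ax; apply: (@continuous_FTC1_closed R v a x (x + 1)) => //.
- by rewrite ltrDl.
- exact: integrable_itv_continuous.
- exact: cv.
Qed.

Lemma eq_of_interval_continuous x : {for x, continuous u} -> u x = v x.
Proof.
move=> cu; have ax : x - 1 < x by rewrite ltrBlDr ltrDl.
have [_ <-] := dv ax; rewrite -Fuv.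
have [|_ ->] // := @continuous_FTC1_closed R u (x - 1) x (x + 1) _ (iuS _ _) ax cu.
by rewrite ltrDl.
Qed.

(** Lebesgue differentiation: u and v have a common antiderivative, whose derivative is u almost
    everywhere and v everywhere. *)
Lemma ae_eq_of_interval : {ae mu, forall x, u x = v x}.
Proof.
have lu : locally_integrable [set: R] u.
  exact: open_integrable_locally openT iu.
(* The base point of the antiderivative must lie to the left of x; the base points -n exhaust the
   line, at the price of countably many null sets. *)
have h (n : nat) : {ae mu, forall x, - n%:R < x -> u x = v x}.
  have := @FTC1 R u (BLeft (- n%:R)) (fun y => iuS _ _) lu.
  move=> H; apply: ae_imp H _ => x H nx.
  have [|_ <-] := H _.
    first [by rewrite lteBSide /= ltW | by rewrite ltBSide /= ltW | by rewrite /Order.lt /= ltW | by case: (leP (BRight x) (BLeft (- n%:R))) ].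
  by rewrite Fuv; case: (dv nx).
have /ae_foralln H := h.
apply: ae_imp H _ => x /(_ (Num.truncn `|x|).+1); apply.
rewrite ltrNl; apply: le_lt_trans (truncnS_gt _).
by rewrite -normrN ler_norm.
Qed.

End IntervalUniqueness.

Lemma c_dct (f_ : nat -> R -> C) (f : R -> C) (g : R -> R) :
  (forall n, cmeas (f_ n)) -> cmeas f ->
  {ae mu, forall x, complex.Re (f_ n x) @[n --> \oo] --> complex.Re (f x) /\
    complex.Im (f_ n x) @[n --> \oo] --> complex.Im (f x)} ->
  intg g -> (forall n x, abs1 (f_ n x) <= g x) ->
  [/\ cintegrable f, complex.Re (cint (f_ n)) @[n --> \oo] --> complex.Re (cint f) &
    complex.Im (cint (f_ n)) @[n --> \oo] --> complex.Im (cint f)].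
Proof.
move=> mf_ [mr mi] cv ig fg.
have [|||ir cr] := @I_dct R (fun n => reF (f_ n)) (reF f) g _ mr _ ig.
- by move=> n; case: (mf_ n).
- by apply: ae_imp cv _ => x [].
- by move=> n x; exact: le_trans (abs1_Re _) (fg n x).
have [|||ii ci] := @I_dct R (fun n => imF (f_ n)) (imF f) g _ mi _ ig.
- by move=> n; case: (mf_ n).
- by apply: ae_imp cv _ => x [].
- by move=> n x; exact: le_trans (abs1_Im _) (fg n x).
by split.
Qed.

Lemma oneD_sqr_gt0 (y : R) : 0 < 1 + y ^+ 2.
Proof. by rewrite ltr_pwDl ?sqr_ge0. Qed.

(** The Poisson kernel of the upper half-plane at height 1/m, written so that its antiderivative is
    visible. *)
Definition poisson (m y : R) : R := pi^-1 * (m / (1 + (m * y) ^+ 2)).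

Lemma poisson_deriv (m y : R) : is_derive y 1 (fun y => pi^-1 * atan (m * y)) (poisson m y).
Proof.
have l := is_derive_mull m y.
have da := is_derive1_comp (g := fun t : R => m * t) (is_derive1_atan (m * y)) l.
apply: (is_derive_eq (is_deriveM (is_derive_cst pi^-1 y 1) da)).
by rewrite /GRing.scale /poisson /=; ring.
Qed.

Lemma poisson_cont (m : R) : continuous (poisson m).
Proof.
move=> y; apply: cvgM; first exact: cvg_cst.
apply: cvgM; first exact: cvg_cst.
apply: cvgV; first by rewrite gt_eqF// ltr_pwDl ?sqr_ge0.
apply: cvgD; first exact: cvg_cst.
rewrite expr2; under eq_fun do rewrite expr2.
by apply: cvgM; apply: cvgM; [exact: cvg_cst|exact: cvg_id|exact: cvg_cst|exact: cvg_id].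
Qed.

Lemma poisson_bound (m y : R) : 0 < m -> `|poisson m y| <= pi^-1 * m.
Proof.
move=> m0; have d0 : 0 < 1 + (m * y) ^+ 2 by rewrite ltr_pwDl ?sqr_ge0.
have pi0 : 0 <= pi^-1 :> R by rewrite invr_ge0 pi_ge0.
rewrite /poisson normrM (ger0_norm pi0) ler_wpM2l// ger0_norm ?divr_ge0 ?(ltW m0) ?(ltW d0)//.
by rewrite ler_pdivrMr// ler_peMr ?(ltW m0)// lerDl sqr_ge0.
Qed.

Definition damp (m : R) (t : R) : C := (expR (- (m^-1 * `|t|)))%:C.

Lemma cmeas_damp m : cmeas (damp m).
Proof. by split; [apply: cont_meas; exact: cont_exp_abs|exact: measurable_cst]. Qed.

Lemma abs1_damp m t : 0 < m -> abs1 (damp m t) <= 1.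
Proof.
move=> m0; rewrite abs1_real ger0_norm ?expR_ge0// expR_le1 oppr_le0 mulr_ge0//.
by rewrite invr_ge0 ltW.
Qed.

Lemma cig_damp m : 0 < m -> cintegrable (damp m).
Proof. by move=> m0; split; [apply: intg_exp_abs; rewrite invr_gt0|exact: intg0]. Qed.

Lemma cmeas2_eix (u : measurableTypeR R * measurableTypeR R -> R) :
  measurable_fun setT u -> cmeas2 (fun z => eix (u z)).
Proof.
move=> mu_; split.
  exact: (measurableT_comp (cont_meas (@continuous_cos R)) mu_).
exact: (measurableT_comp (cont_meas (@continuous_sin R)) mu_).
Qed.

(** The damping makes the double integral absolutely convergent, so the order may be exchanged; the
    inner integral is then the transform of the damping, which is a multiple of the Poisson
    kernel. *)
Lemma fourier_damp (p : R -> C) (m a : R) : 0 < m -> cintegrable p ->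
  ifourier (fun t => fourier p t * damp m t) a =
  cint (fun x => p x * (poisson m (a - x))%:C).
Proof.
move=> m0 ip.
have ih := cig_eix a (cig_damp m0).
have mk : cmeas2 (fun z : measurableTypeR R * measurableTypeR R => eix (- (z.1 * z.2))).
  apply: cmeas2_eix; apply: measurableT_comp => //.
  by apply: measurable_funM; [exact: measurable_fst|exact: measurable_snd].
have := cint_swap ip ih mk (fun z => abs1_eix _); rewrite /= => E.
rewrite /ifourier (@cint_ext _ _ (fun y => eix (a * y) * damp m y *
  cint (fun x => p x * eix (- (x * y))))); last first.
  by move=> t; rewrite mulrA mulrAC.
have pp x : poisson m (a - x) = (2 * pi)^-1 * (2 * m^-1 / (m^-1 ^+ 2 + (a - x) ^+ 2)).
  have p0 : (pi : R) != 0 by rewrite gt_eqF ?pi_gt0.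
  have mn : m != 0 by rewrite gt_eqF.
  have d0 := lt0r_neq0 (oneD_sqr_gt0 (m * (a - x))).
  have -> : m^-1 ^+ 2 + (a - x) ^+ 2 = (1 + (m * (a - x)) ^+ 2) / m ^+ 2 by field.
  rewrite /poisson; move: d0; set D := 1 + _ => d0; clear -p0 mn d0.
  by move: p0; move: (pi : R) => q q0; field; rewrite ?q0 ?mn ?d0.
rewrite -E (@cint_ext _ _ (fun x => p x * (2 * m^-1 / (m^-1 ^+ 2 + (a - x) ^+ 2))%:C)); last first.
  have k0 : 0 < m^-1 by rewrite invr_gt0.
  move=> x; congr (_ * _); rewrite -(cint_poisson (a - x) k0); apply: cint_ext => y.
  by rewrite mulrAC -eixD mulrC; congr (_ * eix _); ring.
rewrite -cintZ.
  by apply: cint_ext => x; rewrite pp rmorphM /=; ring.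
have : cintegrable (fun x => p x * (2 * pi * poisson m (a - x))%:C).
  apply: (cigMb (M := 2 * pi * (pi^-1 * m)) ip).
    split; last exact: measurable_cst.
    apply: cont_meas => x; apply: cvgM; first exact: cvg_cst.
    apply: (continuous_comp (f := fun x => a - x) (g := poisson m)); last exact: poisson_cont.
    by apply: cvgB; [exact: cvg_cst|exact: cvg_id].
  have p2 : 0 <= 2 * pi :> R by rewrite mulr_ge0 ?pi_ge0.
  move=> x; rewrite (abs1_real (2 * pi * poisson m (a - x))) normrM (ger0_norm p2).
  exact: (ler_wpM2l p2 (poisson_bound (a - x) m0)).
congr cintegrable; apply/funext => x; congr (_ * _%:C).
have p2 : 0 < 2 * pi :> R by apply: mulr_gt0; [exact: ltr0n|exact: pi_gt0].
by rewrite pp (mulVKf (lt0r_neq0 p2)).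
Qed.

Lemma atan_cvg (y : R) : 0 < y -> atan (n.+1%:R * y) @[n --> \oo] --> (pi / 2 : R).
Proof.
move=> y0; apply: (cvg_comp (fun n : nat => n.+1%:R * y) atan _ (@cvgy_atan R)).
apply/cvgryPge => A; near=> n.
rewrite -ler_pdivrMr//; apply: le_trans (ler_norm _) _.
apply: (le_trans (ltW (truncnS_gt _))); rewrite ler_nat ltnS.
by near: n; exists (Num.truncn `|A / y|).
Unshelve. all: end_near. Qed.

Lemma atan_cvgN (y : R) : y < 0 -> atan (n.+1%:R * y) @[n --> \oo] --> (- (pi / 2) : R).
Proof.
move=> y0; rewrite (_ : (fun n => _) = fun n => - atan (n.+1%:R * - y)).
  by apply: cvgN; apply: atan_cvg; rewrite oppr_gt0.
by apply/funext => n; rewrite mulrN atanN opprK.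
Qed.

Definition poisson_itv (c d m x : R) : R := pi^-1 * (atan (m * (d - x)) - atan (m * (c - x))).

Lemma poisson_itvE (c d m x : R) : c < d ->
  I (fun a => \1_(`[c, d]) a * poisson m (a - x)) = poisson_itv c d m x.
Proof.
move=> cd; rewrite -Rintegral_indic.
have dF (a : R) : is_derive a 1 (fun a => pi^-1 * atan (m * (a - x))) (poisson m (a - x)).
  have l : is_derive a 1 (fun t : R => t - x) 1.
    apply: (is_derive_eq (is_deriveB (is_derive_id a 1) (is_derive_cst x a 1))).
    by rewrite subr0.
  have := is_derive1_comp (g := fun t : R => t - x) (poisson_deriv m (a - x)) l.
  by rewrite mulr1.
have cf : continuous (fun a => poisson m (a - x)).
  move=> a; apply: (continuous_comp (f := fun a => a - x) (g := poisson m)); last exact: poisson_cont.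
  by apply: cvgB; [exact: cvg_id|exact: cvg_cst].
by rewrite (Rintegral_FTC cd cf dF) /poisson_itv -mulrBr.
Qed.

Lemma poisson_itv_le1 (c d m x : R) : `|poisson_itv c d m x| <= 1.
Proof.
have p0 := @pi_gt0 R.
rewrite /poisson_itv normrM ger0_norm ?invr_ge0 ?(ltW p0)// mulrC ler_pdivrMr// mul1r.
rewrite ler_norml; have := atan_gtNpi2 (m * (d - x)); have := atan_ltpi2 (m * (d - x)).
have := atan_gtNpi2 (m * (c - x)); have := atan_ltpi2 (m * (c - x)).
by move=> *; apply/andP; split; lra.
Qed.

(** At either endpoint the limit is 1/2, hence the two exclusions. *)
Lemma poisson_itv_cvg (c d x : R) : c < d -> x != c -> x != d ->
  poisson_itv c d n.+1%:R x @[n --> \oo] --> (\1_(`]c, d[) x : R).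
Proof.
move=> cd xc xd.
have L (y : R) : y != 0 -> atan (n.+1%:R * y) @[n --> \oo] --> (if 0 < y then pi / 2 else - (pi / 2) : R).
  move=> y0; case: ltP => y1; first exact: atan_cvg.
  by apply: atan_cvgN; rewrite lt_neqAle y0.
have pi0 : (pi : R) != 0 by rewrite gt_eqF ?pi_gt0.
have -> : \1_(`]c, d[) x = pi^-1 * ((if 0 < d - x then pi / 2 else - (pi / 2)) -
    (if 0 < c - x then pi / 2 else - (pi / 2))) :> R.
  rewrite !subr_gt0 indicE.
  case: (ltP x c) => h1.
    rewrite memNset /=; last by rewrite in_itv /= ltNge (ltW h1).
    by rewrite (lt_trans h1 cd) subrr mulr0.
  case: (ltP x d) => h2.
    rewrite mem_set /=; last by rewrite in_itv /= h2 lt_neqAle eq_sym xc h1.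
    by move: pi0; clear; move: (pi : R) => q q0; field.
  rewrite memNset /=; last by rewrite in_itv /= (ltNge x d) h2 andbF.
  by rewrite subrr mulr0.
apply: cvgM; first exact: cvg_cst.
by apply: cvgB; apply: L; rewrite subr_eq0 eq_sym.
Qed.

Lemma ReMr (z : C) (r : R) : complex.Re (z * r%:C) = complex.Re z * r.
Proof. by case: z => a b /=; rewrite mulr0 subr0. Qed.

Lemma ImMr (z : C) (r : R) : complex.Im (z * r%:C) = complex.Im z * r.
Proof. by case: z => a b /=; rewrite mulr0 add0r. Qed.

Lemma cmeas_cont (f : R -> C) : ccontinuous f -> cmeas f.
Proof. by move=> [fr fi]; split; exact: cont_meas. Qed.

Lemma damp_cvg (t : R) : expR (- (n.+1%:R^-1 * `|t|)) @[n --> \oo] --> (1 : R).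
Proof.
rewrite -[X in _ --> X]expR0; apply: continuous_cvg; first exact: continuous_expR.
have H : - (n.+1%:R^-1 * `|t|) @[n --> \oo] --> (- (0 * `|t|) : R).
  by apply: cvgN; apply: cvgM; [exact: cvg_harmonic|exact: cvg_cst].
rewrite mul0r oppr0 in H; exact: H.
Qed.

Lemma ifourier_damp_cvg (g : R -> C) (a : R) : cintegrable g ->
  complex.Re (ifourier (fun t => g t * damp n.+1%:R t) a) @[n --> \oo] --> complex.Re (ifourier g a) /\
  complex.Im (ifourier (fun t => g t * damp n.+1%:R t) a) @[n --> \oo] --> complex.Im (ifourier g a).
Proof.
move=> ig; have mg := cig_meas (cig_eix a ig).
have [||||| _ L1 L2] := @c_dct (fun n t => eix (a * t) * g t * damp n.+1%:R t)
  (fun t => eix (a * t) * g t) (fun t => abs1 (eix (a * t) * g t)).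
- by move=> n; apply: cmeasM => //; exact: cmeas_damp.
- exact: mg.
- apply: aeW => t.
  rewrite -[complex.Re (eix _ * _)]mulr1 -[complex.Im (eix _ * _)]mulr1.
  split; [under eq_fun do rewrite ReMr|under eq_fun do rewrite ImMr].
    by apply: cvgM; [exact: cvg_cst|exact: damp_cvg].
  by apply: cvgM; [exact: cvg_cst|exact: damp_cvg].
- exact/cig_abs1/cig_eix.
- move=> n t; apply: le_trans (abs1M _ _) _.
  by rewrite ler_piMr ?abs1_ge0// abs1_damp.
have E n : ifourier (fun t => g t * damp n.+1%:R t) a =
    cint (fun t => eix (a * t) * g t * damp n.+1%:R t) * ((2 * pi)^-1)%:C.
  by rewrite /ifourier mulrC; congr (_ * _); apply: cint_ext => t; rewrite mulrA.
have E' : ifourier g a = cint (fun t => eix (a * t) * g t) * ((2 * pi)^-1)%:C.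
  by rewrite /ifourier mulrC.
rewrite E' ReMr ImMr; split.
  rewrite (_ : (fun n => _) = fun n => complex.Re (cint (fun t => eix (a * t) * g t * damp n.+1%:R t)) * (2 * pi)^-1).
    by apply: cvgM => //; exact: cvg_cst.
  by apply/funext => n; rewrite E ReMr.
rewrite (_ : (fun n => _) = fun n => complex.Im (cint (fun t => eix (a * t) * g t * damp n.+1%:R t)) * (2 * pi)^-1).
  by apply: cvgM => //; exact: cvg_cst.
by apply/funext => n; rewrite E ImMr.
Qed.

(** Both sides are limits of the integral of the Abel means over the interval. Integrating over the
    interval first replaces the Poisson kernel, whose size grows with n, by a function bounded by 1,
    so dominated convergence applies with majorant [abs1 (p x)]. On the other side the Abel means
    converge at every point and are uniformly bounded by twice the norm of [fourier p]. *)
Lemma interval_inversion (p : R -> C) (c d : R) : c < d -> cintegrable p ->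
  cintegrable (fourier p) ->
  cint (fun x => p x * (\1_(`]c, d[) x)%:C) = cint (fun a => ifourier (fourier p) a * (\1_(`[c, d]) a)%:C).
Proof.
move=> cd ip ih.
have mi (D : set R) : measurable D -> cmeas (fun x => (\1_D x)%:C : C).
  by move=> mD; split; [exact: meas_indic|exact: measurable_cst].
have i1 (D : set R) x : abs1 ((\1_D x)%:C : C) <= 1 by rewrite abs1_real indic_le1.
have icd : cintegrable (fun x => (\1_(`[c, d]) x)%:C : C).
  split; last exact: intg0.
  by apply: integrable_indic_itv.
have id n : cintegrable (fun t => fourier p t * damp n.+1%:R t).
  by apply: cigMb ih (cmeas_damp _) _ => t; exact: abs1_damp.
have key n : cint (fun a => (\1_(`[c, d]) a)%:C * ifourier (fun t => fourier p t * damp n.+1%:R t) a) =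
    cint (fun x => p x * (poisson_itv c d n.+1%:R x)%:C).
  have mk : cmeas2 (fun z : measurableTypeR R * measurableTypeR R => (poisson n.+1%:R (z.2 - z.1))%:C : C).
    split; last exact: measurable_cst.
    apply: (measurableT_comp (cont_meas (@poisson_cont n.+1%:R))).
    by apply: measurable_funB; [exact: measurable_snd|exact: measurable_fst].
  rewrite (@cint_ext _ _ (fun a => (\1_(`[c, d]) a)%:C * cint (fun x => p x * (poisson n.+1%:R (a - x))%:C))); last first.
    by move=> a; rewrite fourier_damp.
  have pb (z : measurableTypeR R * measurableTypeR R) :
    abs1 ((poisson n.+1%:R (z.2 - z.1))%:C : C) <= pi^-1 * n.+1%:R.
    by rewrite abs1_real; exact: poisson_bound.
  have /= <- := cint_swap ip icd mk pb.
  apply: cint_ext => x; congr (_ * _); rewrite -poisson_itvE// /cint; congr (_ +i* _).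
    by apply: I_ext => a; rewrite /reF /=; ring.
  by rewrite (@I_ext _ _ (fun=> 0)) => [|a]; rewrite ?/Rintegral ?integral0// /imF /=; ring.
have [||||| _ L1 L2] := @c_dct (fun n x => p x * (poisson_itv c d n.+1%:R x)%:C)
  (fun x => p x * (\1_(`]c, d[) x)%:C) (fun x => abs1 (p x)).
- move=> n; apply: cmeasM; first exact: cig_meas.
  split; last exact: measurable_cst.
  have ca (k : R) : continuous (fun x : R => atan (n.+1%:R * (k - x))).
    have cA : continuous (@atan R) by move=> z; exact: continuous_atan.
    move=> x; apply: (continuous_comp (f := fun x : R => n.+1%:R * (k - x)) (g := @atan R)); last exact: cA.
    apply: cvgM; first exact: cvg_cst.
    by apply: cvgB; [exact: cvg_cst|exact: cvg_id].
  apply: cont_meas => x; apply: cvgM; first exact: cvg_cst.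
  by apply: cvgB; exact: ca.
- by apply: cmeasM; [exact: cig_meas|exact: mi].
- apply: ae_imp2 (ae_neq c) (ae_neq d) _ => x xc xd; rewrite ReMr ImMr.
  split; [under eq_fun do rewrite ReMr|under eq_fun do rewrite ImMr].
    by apply: cvgM; [exact: cvg_cst|exact: poisson_itv_cvg].
  by apply: cvgM; [exact: cvg_cst|exact: poisson_itv_cvg].
- exact: cig_abs1.
- move=> n x; apply: le_trans (abs1M _ _) _; rewrite ler_piMr ?abs1_ge0// abs1_real.
  exact: poisson_itv_le1.
have [||||| _ M1 M2] := @c_dct (fun n a => ifourier (fun t => fourier p t * damp n.+1%:R t) a * (\1_(`[c, d]) a)%:C)
  (fun a => ifourier (fourier p) a * (\1_(`[c, d]) a)%:C) (fun a => (2 * wnorm (fourier p)) * abs1 ((\1_(`[c, d]) a)%:C : C)).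
- by move=> n; apply: cmeasM; [exact/cmeas_cont/ifourier_continuous|exact: mi].
- by apply: cmeasM; [exact/cmeas_cont/ifourier_continuous|exact: mi].
- apply: aeW => a; have [c1 c2] := ifourier_damp_cvg a ih; rewrite ReMr ImMr.
  split; [under eq_fun do rewrite ReMr|under eq_fun do rewrite ImMr].
    by apply: cvgM => //; exact: cvg_cst.
  by apply: cvgM => //; exact: cvg_cst.
- exact/intgZ/cig_abs1.
- move=> n a; apply: le_trans (abs1M _ _) _; rewrite ler_wpM2r ?abs1_ge0//.
  apply: le_trans (ifourier_abs1 a (id n)) _; rewrite ler_wpM2l//.
  have := wnormMb ih (cmeas_damp n.+1%:R) (fun t => abs1_damp t (ltr0Sn R n)).
  by rewrite mul1r.
have key' n : cint (fun a => ifourier (fun t => fourier p t * damp n.+1%:R t) a * (\1_(`[c, d]) a)%:C) =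
    cint (fun x => p x * (poisson_itv c d n.+1%:R x)%:C).
  by rewrite -key; apply: cint_ext => a; rewrite mulrC.
apply/eqP; rewrite eq_complex; apply/andP; split; apply/eqP.
  apply: (cvg_unique (@Rhausdorff R) L1); move: M1.
  by under eq_fun do rewrite key'.
apply: (cvg_unique (@Rhausdorff R) L2); move: M2.
by under eq_fun do rewrite key'.
Qed.

Lemma fourier_inversion (p : R -> C) : cintegrable p -> cintegrable (fourier p) ->
  {ae mu, forall x, p x = ifourier (fourier p) x} /\
  (ccontinuous p -> forall x, p x = ifourier (fourier p) x).
Proof.
move=> ip ih; have [qr qi] := ifourier_continuous ih.
have E c d (cd : c < d) := interval_inversion cd ip ih.
have Ere c d : c < d -> Rintegral mu `[c, d] (reF p) = Rintegral mu `[c, d] (reF (ifourier (fourier p))).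
  move=> cd; have /(congr1 (@complex.Re R)) := E c d cd; rewrite /cint /=.
  rewrite (@I_ext _ _ (fun x => \1_`]c, d[ x * reF p x)); last by move=> x; rewrite /reF ReMr mulrC.
  rewrite [RHS](@I_ext _ _ (fun x => \1_`[c, d] x * reF (ifourier (fourier p)) x)); last first.
    by move=> x; rewrite /reF ReMr mulrC.
  rewrite -!Rintegral_indic => <-.
  rewrite -Rintegral_itv_bndo_bndc -?Rintegral_itv_obnd_cbnd//.
  1,2: by apply: (integrableS measurableT _ (@subsetT _ _) ip.1).
have Eim c d : c < d -> Rintegral mu `[c, d] (imF p) = Rintegral mu `[c, d] (imF (ifourier (fourier p))).
  move=> cd; have /(congr1 (@complex.Im R)) := E c d cd; rewrite /cint /=.
  rewrite (@I_ext _ _ (fun x => \1_`]c, d[ x * imF p x)); last by move=> x; rewrite /imF ImMr mulrC.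
  rewrite [RHS](@I_ext _ _ (fun x => \1_`[c, d] x * imF (ifourier (fourier p)) x)); last first.
    by move=> x; rewrite /imF ImMr mulrC.
  rewrite -!Rintegral_indic => <-.
  rewrite -Rintegral_itv_bndo_bndc -?Rintegral_itv_obnd_cbnd//.
  1,2: by apply: (integrableS measurableT _ (@subsetT _ _) ip.2).
have eqc x : reF p x = reF (ifourier (fourier p)) x -> imF p x = imF (ifourier (fourier p)) x ->
    p x = ifourier (fourier p) x.
  by rewrite /reF /imF; case: (p x) (ifourier _ x) => ? ? [? ?] /= -> ->.
split.
  apply: ae_imp2 (ae_eq_of_interval ip.1 qr Ere) (ae_eq_of_interval ip.2 qi Eim) _.
  exact: eqc.
move=> [pr pi] x; apply: eqc.
  exact: (eq_of_interval_continuous ip.1 qr Ere (pr x)).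
exact: (eq_of_interval_continuous ip.2 qi Eim (pi x)).
Qed.

End FourierInversion.

(** * The Riemann-Lebesgue lemma *)

Section RiemannLebesgue.
Context {R : realType}.
Local Notation C := R[i].
Local Notation mu := (@lebesgue_measure R).
Local Notation intg f := (mu.-integrable setT (EFin \o f)).
Local Notation I f := (Rintegral mu setT f).

Definition osc_vanish (u : R -> R) : Prop := forall e, 0 < e ->
  exists X : R, forall x, X <= `|x| ->
    `|I (fun t => u t * cos (x * t))| <= e /\ `|I (fun t => u t * sin (x * t))| <= e.

Lemma intg_cos (u : R -> R) x : intg u -> intg (fun t => u t * cos (x * t)).
Proof. by move=> iu; apply: (intgM iu (cmeas_eix x).1) => t; exact: cos_le1n. Qed.

Lemma intg_sin (u : R -> R) x : intg u -> intg (fun t => u t * sin (x * t)).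
Proof. by move=> iu; apply: (intgM iu (cmeas_eix x).2) => t; exact: sin_le1n. Qed.

(** Since sine and cosine are bounded by 1, the oscillatory integrals change by at most the L^1
    distance, uniformly in x. This reduces the Riemann-Lebesgue lemma to a dense class. *)
Lemma osc_vanish_closed (u : R -> R) : intg u ->
  (forall e, 0 < e -> exists v, [/\ intg v, osc_vanish v & I (fun t => `|u t - v t|) <= e]) ->
  osc_vanish u.
Proof.
move=> iu H e e0; have e2 : 0 < e / 2 by rewrite divr_gt0.
have [v [iv vv uv]] := H _ e2; have [X XP] := vv _ e2.
have iuv := intgB iu iv.
exists X => x /XP[h1 h2]; split.
  have -> : I (fun t => u t * cos (x * t)) =
      I (fun t => (u t - v t) * cos (x * t)) + I (fun t => v t * cos (x * t)).
    by rewrite -ID; [apply: I_ext => t; ring|exact: intg_cos|exact: intg_cos].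
  apply: le_trans (ler_normD _ _) _; rewrite [leRHS](splitr e); apply: lerD h1.
  apply: le_trans _ uv; apply: I_norm_le => [||t]; [exact: intg_cos|exact: intg_norm|].
  by rewrite normrM ler_piMr ?cos_le1n.
have -> : I (fun t => u t * sin (x * t)) =
    I (fun t => (u t - v t) * sin (x * t)) + I (fun t => v t * sin (x * t)).
  by rewrite -ID; [apply: I_ext => t; ring|exact: intg_sin|exact: intg_sin].
apply: le_trans (ler_normD _ _) _; rewrite [leRHS](splitr e); apply: lerD h2.
apply: le_trans _ uv; apply: I_norm_le => [||t]; [exact: intg_sin|exact: intg_norm|].
by rewrite normrM ler_piMr ?sin_le1n.
Qed.

Lemma Rintegral_FTC_local (f F : R -> R) (a b : R) : a < b ->
  (forall t, a <= t <= b -> {for t, continuous f}) ->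
  (forall t : R, a <= t <= b -> is_derive t 1 F (f t)) -> Rintegral mu `[a, b] f = F b - F a.
Proof.
move=> ab cf dF; rewrite /Rintegral (@continuous_FTC2 _ f F a b ab)//.
- apply: continuous_in_subspaceT => t; rewrite inE /= in_itv /=; exact: cf.
- have cF t : a <= t <= b -> {for t, continuous F}.
    by move=> h; apply: derivable_continuous; case: (dF t h).
  split.
  + move=> t; rewrite in_itv /= => /andP[h1 h2].
    by have [|//] := dF t _; rewrite !ltW.
  + by apply: cvg_at_right_filter; apply: cF; rewrite lexx ltW.
  + by apply: cvg_at_left_filter; apply: cF; rewrite lexx ltW.
- move=> t; rewrite in_itv /= => /andP[h1 h2]; rewrite derive1E.
  by have [|_ ->//] := dF t _; rewrite !ltW.
Qed.

Lemma intg_indicM (D : set R) (f : R -> R) : measurable D ->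
  mu.-integrable D (EFin \o f) -> intg (fun t => \1_D t * f t).
Proof.
move=> mD; rewrite integrable_mkcond//=.
congr (_.-integrable _ _); apply/funext => t; rewrite patchE /= indicE.
by case: ifP => _; rewrite ?mul1r ?mul0r.
Qed.

(** Integration by parts gives a bound K/|x|, with K made of the boundary values of G and the
    integral of |g|. *)
Lemma osc_vanish_C1 (G g : R -> R) (a b : R) : a < b ->
  (forall t, a <= t <= b -> {for t, continuous g}) ->
  (forall t : R, a <= t <= b -> is_derive t 1 G (g t)) ->
  osc_vanish (fun t => \1_(`[a, b]) t * G t).
Proof.
move=> ab cg dG.
have cG t : a <= t <= b -> {for t, continuous G}.
  by move=> h; apply: derivable_continuous; case: (dG t h).
have iS (f : R -> R) : (forall t, a <= t <= b -> {for t, continuous f}) ->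
    mu.-integrable `[a, b] (EFin \o f).
  move=> cf; apply: continuous_compact_integrable; first exact: segment_compact.
  by apply: continuous_in_subspaceT => t; rewrite inE /= in_itv /=; exact: cf.
have ci (h : R -> R) (x : R) : continuous h -> continuous (fun t : R => h (x * t)).
  move=> ch t; apply: (continuous_comp (f := fun t : R => x * t) (g := h)); last exact: ch.
  exact: mulrl_continuous.
have ms (h : R -> R) (h1 : forall t, `|h t| <= 1) (ch : continuous h) x :
    `|Rintegral mu `[a, b] (fun t => g t * h (x * t))| <= Rintegral mu `[a, b] (fun t => `|g t|).
  have ig : mu.-integrable `[a, b] (EFin \o (fun t => g t * h (x * t))).
    by apply: iS => t ht; apply: cvgM; [exact: cg|exact: ci].
  apply: le_trans (le_normr_Rintegral _ ig) _ => //.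
  apply: le_Rintegral => //; first exact: integrable_norm.
    exact/integrable_norm/iS.
  by move=> t _ /=; rewrite normrM ler_piMr.
set K := `|G a| + `|G b| + Rintegral mu `[a, b] (fun t => `|g t|).
have K0 : 0 <= K by rewrite !addr_ge0 ?Rintegral_ge0.
(* Up to the sign s and the factor x, h is an antiderivative of k; the triples (sin, cos, 1) and
   (cos, sin, -1) give the two required bounds. *)
have bound (h k : R -> R) x s : x != 0 -> `|s| = 1 ->
    (forall t, `|h t| <= 1) -> (forall t, `|k t| <= 1) -> continuous h -> continuous k ->
    (forall t : R, is_derive t 1 (fun t => h (x * t)) (s * x * k (x * t))) ->
    `|I (fun t => \1_(`[a, b]) t * G t * k (x * t))| <= K / `|x|.
  move=> x0 s1 h1 k1 ch ck dh.
  have d1 (t : R) : a <= t <= b ->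
     is_derive t 1 (fun t => G t * h (x * t)) (g t * h (x * t) + (s * x) * (G t * k (x * t))).
    move=> ht; apply: (is_derive_eq (is_deriveM (dG t ht) (dh t))).
    by rewrite /GRing.scale /=; ring.
  have c1 t : a <= t <= b -> {for t, continuous (fun t => g t * h (x * t))}.
    by move=> ht; apply: cvgM; [exact: cg|exact: ci].
  have c2 t : a <= t <= b -> {for t, continuous (fun t => G t * k (x * t))}.
    by move=> ht; apply: cvgM; [exact: cG|exact: ci].
  have c3 t : a <= t <= b -> {for t, continuous (fun t => (s * x) * (G t * k (x * t)))}.
    by move=> ht; apply: cvgM; [exact: cvg_cst|exact: c2].
  have E : G b * h (x * b) - G a * h (x * a) = Rintegral mu `[a, b] (fun t => g t * h (x * t)) +
      (s * x) * Rintegral mu `[a, b] (fun t => G t * k (x * t)).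
    rewrite -(@Rintegral_FTC_local (fun t => g t * h (x * t) + (s * x) * (G t * k (x * t))) _ a b ab _ d1).
      by rewrite RintegralD ?RintegralZl//; exact: iS.
    by move=> t ht; apply: cvgD; [exact: c1|exact: c3].
  rewrite (@I_ext _ _ (fun t => \1_(`[a, b]) t * (G t * k (x * t)))); last by move=> t; rewrite mulrA.
  rewrite -Rintegral_indic ler_pdivlMr ?normr_gt0// -normrM.
  have -> : `|Rintegral mu `[a, b] (fun t => G t * k (x * t)) * x| =
      `|(s * x) * Rintegral mu `[a, b] (fun t => G t * k (x * t))|.
    by rewrite !normrM s1 mul1r mulrC.
  have -> : (s * x) * Rintegral mu `[a, b] (fun t => G t * k (x * t)) =
     G b * h (x * b) - G a * h (x * a) - Rintegral mu `[a, b] (fun t => g t * h (x * t)).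
    by rewrite E; ring.
  apply: le_trans (ler_normB _ _) _; rewrite /K; apply: lerD; last exact: ms.
  apply: le_trans (ler_normB _ _) _; rewrite addrC !normrM.
  by apply: lerD; rewrite ler_piMr.
(* The threshold K/e gives the bound; the added 1 keeps x away from 0. *)
move=> e e0; exists (K / e + 1) => x hx.
have xp : 0 < `|x| by apply: lt_le_trans hx; rewrite ltr_pwDr// divr_ge0// ltW.
have xn : x != 0 by rewrite -normr_gt0.
have Ke : K / `|x| <= e.
  rewrite ler_pdivrMr// mulrC -ler_pdivrMr//; apply: le_trans hx; by rewrite lerDl.
have l (t : R) := is_derive_mull x t.
split; apply: le_trans Ke.
  apply: (bound sin cos x 1) => //.
  - by rewrite normr1.
  - exact: sin_le1n.
  - exact: cos_le1n.
  - exact: continuous_sin.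
  - exact: continuous_cos.
  - move=> t; have := is_derive1_comp (g := fun t : R => x * t) (is_derive_sin (x * t)) (l t).
    by rewrite mul1r mulrC.
apply: (bound cos sin x (-1)) => //.
- by rewrite normrN normr1.
- exact: cos_le1n.
- exact: sin_le1n.
- exact: continuous_cos.
- exact: continuous_sin.
- move=> t; have := is_derive1_comp (g := fun t : R => x * t) (is_derive_cos (x * t)) (l t).
  by move=> d; apply: (is_derive_eq d); ring.
Qed.

(* [g] is replaced by its averages over [[t, t + 1/(k+1)]], which are C^1. *)
Lemma osc_vanish_continuous (g : R -> R) (a b : R) : a < b -> continuous g ->
  osc_vanish (fun t => \1_(`[a, b]) t * g t).
Proof.
(* The antiderivative starts at a - 1, so that it is differentiable at the endpoint a too. *)
move=> ab cg; pose H t := Rintegral mu `[a - 1, t] g.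
have ig : intg (fun t => \1_(`[a, b]) t * g t).
  by apply: intg_indicM => //; exact: integrable_itv_continuous.
have dH (t : R) : a - 1 < t -> is_derive t 1 H (g t).
  move=> at1; have [|||d1 d2] := @continuous_FTC1_closed R g (a - 1) t (t + 1) _ _ at1 _.
  - by rewrite ltrDl.
  - exact: integrable_itv_continuous.
  - exact: cg.
  - apply: DeriveDef; first exact: d1.
    by rewrite -derive1E; exact: d2.
pose G (k : nat) t := k.+1%:R * (H (t + k.+1%:R^-1) - H t).
pose G' (k : nat) t := k.+1%:R * (g (t + k.+1%:R^-1) - g t).
have k0 (k : nat) : 0 < k.+1%:R^-1 :> R by rewrite invr_gt0.
have k1 (k : nat) : k.+1%:R^-1 <= 1 :> R by rewrite invf_le1// ler1n.
have cG' k : continuous (G' k).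
  move=> t; apply: cvgM; first exact: cvg_cst.
  apply: cvgB; last exact: cg.
  apply: (continuous_comp (f := fun t : R => t + k.+1%:R^-1) (g := g)); last exact: cg.
  by apply: cvgD; [exact: cvg_id|exact: cvg_cst].
have dG k (t : R) : a <= t <= b -> is_derive t 1 (G k) (G' k t).
  move=> /andP[t1 t2].
  have l : is_derive t 1 (fun s : R => s + k.+1%:R^-1) 1.
    pose r : R := k.+1%:R^-1.
    apply: (is_derive_eq (is_deriveD (is_derive_id t 1) (is_derive_cst r t 1))).
    by rewrite addr0.
  have h2 : a - 1 < t by lra.
  have h1 : a - 1 < t + k.+1%:R^-1 by apply: (lt_le_trans h2); rewrite lerDl ltW.
  have d1 := is_derive1_comp (g := fun s : R => s + k.+1%:R^-1) (dH _ h1) l.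
  pose K : R := k.+1%:R.
  apply: (is_derive_eq (is_deriveM (is_derive_cst K t 1) (is_deriveB d1 (dH _ h2)))).
  by rewrite /GRing.scale /G' /K /=; ring.
(* By the mean value theorem each average is a value of g close to t; this yields both the pointwise
   convergence and the domination. *)
have GE k (t : R) : a <= t -> exists2 c : R, t <= c <= t + k.+1%:R^-1 & G k t = g c.
  move=> at1; have tk : t <= t + k.+1%:R^-1 by rewrite lerDl ltW.
  have [||c] := @MVT_segment R H g t (t + k.+1%:R^-1) tk.
  - move=> x; rewrite in_itv /= => /andP[h1 h2]; apply: dH; lra.
  - apply: continuous_in_subspaceT => x; rewrite inE /= in_itv /= => /andP[h1 h2].
    by apply: derivable_continuous; have [|//] := dH x _; lra.
  - rewrite in_itv /= => hc E; exists c => //.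
    by rewrite /G E addrAC subrr add0r mulrCA divff ?mulr1// gt_eqF.
(* The averages look ahead by 1/(k+1), at most 1, so g is bounded on the longer interval up to b +
   1. *)
have [M M0 gM] : exists2 M, 0 <= M & forall t, a <= t <= b + 1 -> `|g t| <= M.
  have ab1 : a <= b + 1 by lra.
  have [|c _ cM] := @EVT_max R (fun t => `|g t|) a (b + 1) ab1.
    apply: continuous_subspaceT => t; apply: continuous_comp; first exact: cg.
    exact: norm_continuous.
  exists `|g c| => // t ht; apply: cM; by rewrite in_itv.
have GM k t : `|\1_(`[a, b]) t * G k t| <= M * \1_(`[a, b]) t.
  rewrite indicE; have [tab|] := boolP (t \in _); last by rewrite !mul0r normr0 mulr0.
  rewrite mul1r mulr1; move: tab; rewrite inE /= in_itv /= => /andP[t1 t2].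
  have [c /andP[c1 c2] ->] := GE k t t1; apply: gM.
  by rewrite (le_trans t1 c1) /= (le_trans c2)// lerD// k1.
have mG k : measurable_fun setT (fun t => \1_(`[a, b]) t * G k t).
  apply: intg_meas; apply: intg_indicM => //.
  apply: continuous_compact_integrable; first exact: segment_compact.
  apply: continuous_in_subspaceT => t; rewrite inE /= in_itv /= => ht.
  by apply: derivable_continuous; case: (dG k t ht).
have iM : intg (fun t => M * \1_(`[a, b]) t) by apply: intgZ; exact: integrable_indic_itv.
have cvG : I (fun t => `|\1_(`[a, b]) t * g t - \1_(`[a, b]) t * G k t|) @[k --> \oo] --> (0 : R).
  have [||||| _ cv] := @I_dct R (fun k t => `|\1_(`[a, b]) t * g t - \1_(`[a, b]) t * G k t|)
    (fun=> 0) (fun t => `|\1_(`[a, b]) t * g t| + M * \1_(`[a, b]) t).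
  - by move=> k; apply: measurableT_comp => //; apply: measurable_funB => //; exact: intg_meas.
  - exact: measurable_cst.
  - apply: aeW => t; have [tab|tab] := boolP (t \in `[a, b]%classic); last first.
      rewrite indicE (negbTE tab); under eq_fun do rewrite !mul0r subrr normr0; exact: cvg_cst.
    rewrite indicE tab; under eq_fun do rewrite !mul1r.
    move: tab; rewrite inE /= in_itv /= => /andP[t1 t2].
    apply/cvgrPdist_le => e e0 /=.
    have /cvgrPdist_le /(_ _ e0) := cg t.
    move=> /nbhs_ballP[d /= d0 hd].
    near=> k; rewrite sub0r normrN normr_id.
    have [c /andP[c1 c2] ->] := GE k t t1.
    apply: hd; rewrite /ball /= ler0_norm; last by lra.
    rewrite opprB; apply: (@le_lt_trans _ _ k.+1%:R^-1); first by rewrite lerBlDl.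
    near: k; exact: near_infty_natSinv_lt (PosNum d0).
  - by apply: intgD => //; exact: intg_norm.
  - by move=> k t; rewrite normr_id; apply: le_trans (ler_normB _ _) _; rewrite lerD2l.
  - by move: cv; rewrite [X in _ --> X](_ : _ = 0)// /Rintegral integral0.
apply: osc_vanish_closed => // e e0.
have /cvgrPdist_le /(_ _ e0) [k _ /(_ k (leqnn k))] := cvG.
rewrite sub0r normrN ger0_norm; last by apply: I_ge0.
move=> ke; exists (fun t => \1_(`[a, b]) t * G k t); split => //.
  exact: intg_le (mG k) (GM k) iM.
apply: (@osc_vanish_C1 _ (G' k)) => // t _; exact: cG'.
Unshelve. all: end_near. Qed.

(** Half of e pays for truncating u to a bounded interval, the other half for replacing it there by
    a continuous function. *)
Lemma riemann_lebesgue (u : R -> R) : intg u -> osc_vanish u.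
Proof.
move=> iu; apply: osc_vanish_closed => // e e0.
have e2 : 0 < e / 2 by rewrite divr_gt0.
pose E (n : nat) := `[- n.+1%:R, n.+1%:R]%classic : set R.
have mi n : intg (fun t => \1_(E n) t * u t).
  by apply: intg_indicM; [exact: measurable_itv|apply: (@integrableS _ _ _ mu setT) => //; exact: measurable_itv].
have cvE : I (fun t => `|u t - \1_(E n) t * u t|) @[n --> \oo] --> (0 : R).
  have [||||| _ cv] := @I_dct R (fun n t => `|u t - \1_(E n) t * u t|)
    (fun=> 0) (fun t => `|u t| + `|u t|).
  - by move=> n; apply: measurableT_comp => //; apply: measurable_funB; exact: intg_meas.
  - exact: measurable_cst.
  - apply: aeW => t; apply: cvg_near_cst; near=> n.
    rewrite indicE mem_set ?mul1r ?subrr ?normr0//.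
    rewrite /E /= in_itv /= -ler_norml.
    near: n; exists (Num.truncn `|t|) => // m /= mx.
    by apply: (le_trans (ltW (truncnS_gt _))); rewrite ler_nat ltnS.
  - by apply: intgD; exact: intg_norm.
  - move=> n t; rewrite normr_id; apply: le_trans (ler_normB _ _) _; rewrite lerD2l normrM.
    by rewrite ler_piMl ?indic_le1.
  - by move: cv; rewrite [X in _ --> X](_ : _ = 0)// /Rintegral integral0.
have /cvgrPdist_le /(_ _ e2) [n _ /(_ n (leqnn n))] := cvE.
rewrite sub0r normrN ger0_norm; last by apply: I_ge0.
move=> ne.
have iE : mu.-integrable (E n) (EFin \o u) by apply: (@integrableS _ _ _ mu setT) => //; exact: measurable_itv.
have [||g_ [cg ig cvg]] := @approximation_continuous_integrable R (E n) u _ _ iE.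
- exact: measurable_itv.
- suff H : (mu (E n) < +oo)%E by exact: H.
  rewrite /E lebesgue_measure_itv /=; case: ifP => _; rewrite ?ltry//.
have /fine_cvgP[_ /cvgrPdist_le /(_ _ e2) [k _ /(_ k (leqnn k))]] := cvg.
rewrite sub0r normrN ger0_norm /=; last by apply: fine_ge0; apply: integral_ge0.
move=> ke.
have icg : intg (fun t => \1_(E n) t * g_ k t) by apply: intg_indicM; [exact: measurable_itv|exact: ig].
exists (fun t => \1_(E n) t * g_ k t); split => //.
  by apply: osc_vanish_continuous => //; rewrite -subr_gt0 opprK addr_gt0.
have iug : intg (fun t => \1_(E n) t * `|u t - g_ k t|).
  have := intg_norm (intgB (mi n) icg); congr (_.-integrable _ (_ \o _)); apply/funext => t.
  by rewrite -mulrBr normrM ger0_norm// indicE.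
apply: (@le_trans _ _ (I (fun t => `|u t - \1_(E n) t * u t| + \1_(E n) t * `|u t - g_ k t|))).
  apply: I_le => [||t].
  - exact/intg_norm/intgB.
  - by apply: intgD iug; exact/intg_norm/intgB.
  - rewrite (_ : u t - \1_(E n) t * g_ k t = (u t - \1_(E n) t * u t) + \1_(E n) t * (u t - g_ k t)); last by ring.
    apply: le_trans (ler_normD _ _) _; rewrite lerD2l normrM.
    by rewrite (_ : `|\1_(E n) t| = \1_(E n) t) // indicE ger0_norm.
rewrite ID//; last exact/intg_norm/intgB.
rewrite [leRHS](splitr e); apply: lerD => //.
by rewrite -Rintegral_indic.
Unshelve. all: end_near. Qed.

End RiemannLebesgue.

(** * Schwartz functions *)

Section Schwartz.
Context {R : realType}.
Local Notation C := R[i].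
Local Notation mu := (@lebesgue_measure R).
Local Notation intg f := (mu.-integrable setT (EFin \o f)).
Local Notation I f := (Rintegral mu setT f).

Lemma fourier_vanish (g : R -> C) : cintegrable g -> forall e, 0 < e ->
  exists X : R, forall x, X <= `|x| -> abs1 (ifourier g x) <= e.
Proof.
move=> [gr gi] e e0.
have [X1 h1] := riemann_lebesgue gr e0; have [X2 h2] := riemann_lebesgue gi e0.
exists (Num.max X1 X2) => x; rewrite ge_max => /andP[/h1[a1 a2] /h2[b1 b2]].
have c00 := @c0_ge0 R; have c04 := @c0_le R.
have tb (u v : R -> R) : intg u -> intg v -> `|I (fun t => u t * cos (x * t))| <= e ->
    `|I (fun t => v t * sin (x * t))| <= e -> `|trig_int u v x| <= 2 * e.
  move=> iu iv hu hv.
  have -> : trig_int u v x = I (fun t => u t * cos (x * t)) - I (fun t => v t * sin (x * t)).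
    rewrite -IB; [|exact: intg_cos|exact: intg_sin].
    by apply: I_ext => t; rewrite mulrC (mulrC (sin _)).
  by apply: le_trans (ler_normB _ _) _; rewrite mulrDl mul1r; exact: lerD.
have t1 := tb _ _ gr gi a1 b2.
have t2 : `|trig_int (imF g) (fun t => - reF g t) x| <= 2 * e.
  apply: tb => //; first exact: intgN.
  rewrite (_ : I _ = - I (fun t => reF g t * sin (x * t))) ?normrN//.
  by rewrite -IN; [apply: I_ext => t; rewrite mulNr|exact: intg_sin].
have h (y : R) : `|y| <= 2 * e -> `|(2 * pi)^-1 * y| <= e / 2.
  move=> hy; rewrite normrM (ger0_norm c00).
  apply: le_trans (ler_pM c00 (normr_ge0 _) c04 hy) _; lra.
rewrite /abs1 -/(reF (ifourier g) x) -/(imF (ifourier g) x) reF_ifourier imF_ifourier.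
by rewrite [leRHS](splitr e); apply: lerD; exact: h.
Qed.

Lemma schwartz_decay (u : R -> R) : schwartzR u -> forall n, exists K : R, forall x,
  `|derive1n n u x| <= K * (1 + x ^+ 2)^-1.
Proof.
move=> [_ su] n; have [M0 h0] := su 0%N n; have [M2 h2] := su 2%N n.
exists (M0 + M2) => x; rewrite ler_pdivlMr ?oneD_sqr_gt0// mulrDr mulr1.
apply: lerD; first by have := h0 x; rewrite expr0 mul1r.
by have := h2 x; rewrite normrM mulrC normrX real_normK ?num_real.
Qed.

Lemma schwartz_cvg0 (u : R -> R) (s : R) : schwartzR u -> `|s| = 1 -> forall n,
  derive1n n u (s * k.+1%:R) @[k --> \oo] --> (0 : R).
Proof.
move=> su s1 n; have [M1 h1] := su.2 1%N n.
have cv : M1 * k.+1%:R^-1 @[k --> \oo] --> (0 : R).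
  rewrite -[X in _ --> X](mulr0 M1); apply: cvgM; first exact: cvg_cst.
  exact: cvg_harmonic.
apply/norm_cvg0P; apply: (squeeze_cvgr _ (@cvg_cst _ 0 _ _ _) cv).
apply: nearW => k; rewrite normr_ge0 /= ler_pdivlMr//.
by have := h1 (s * k.+1%:R); rewrite expr1 !normrM s1 mul1r mulrC (ger0_norm (ler0n _ _)).
Qed.

Lemma schwartz_is_derive (u : R -> R) n (x : R) : schwartzR u ->
  is_derive x 1 (derive1n n u) (derive1n n.+1 u x).
Proof.
move=> [su _]; apply: DeriveDef; first exact: su.
by rewrite derive1nS derive1E.
Qed.

Lemma schwartz_cont (u : R -> R) n : schwartzR u -> continuous (derive1n n u).
Proof. by move=> su; apply: is_derive_cont => x; exact: schwartz_is_derive. Qed.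

Lemma schwartz_cont0 (u : R -> R) : schwartzR u -> continuous u.
Proof. by move=> su; have := @schwartz_cont u 0%N su. Qed.

Lemma schwartz_intg (u : R -> R) n : schwartzR u -> intg (derive1n n u).
Proof.
move=> su; have [K hK] := schwartz_decay su n.
apply: (intg_le _ hK); first by apply: cont_meas; exact: schwartz_cont.
exact/intgZ/intg_oneDsqrV.
Qed.

(* One application of the fundamental theorem to
   [u' (al cos + be sin) + y u (al sin - be cos)]; it gives [(1 + y^2) F(u) = F(u - u'')]. *)
Lemma schwartz_by_parts (u : R -> R) (y al be : R) : schwartzR u ->
  intg (fun t => (derive1n 2 u t + y ^+ 2 * u t) * (al * cos (y * t) + be * sin (y * t))) /\
  I (fun t => (derive1n 2 u t + y ^+ 2 * u t) * (al * cos (y * t) + be * sin (y * t))) = 0.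
Proof.
move=> su.
pose f t := (derive1n 2 u t + y ^+ 2 * u t) * (al * cos (y * t) + be * sin (y * t)).
pose F t := derive1n 1 u t * (al * cos (y * t) + be * sin (y * t)) +
  y * u t * (al * sin (y * t) - be * cos (y * t)).
have l (t : R) := is_derive_mull y t.
have dc (t : R) := is_derive1_comp (g := fun t : R => y * t) (is_derive_cos (y * t)) (l t).
have ds (t : R) := is_derive1_comp (g := fun t : R => y * t) (is_derive_sin (y * t)) (l t).
have dlin (a b : R) (t : R) : is_derive t 1 (fun t => a * cos (y * t) + b * sin (y * t))
    (y * (b * cos (y * t) - a * sin (y * t))).
  apply: (is_derive_eq (is_deriveD (is_deriveM (is_derive_cst a t 1) (dc t))
    (is_deriveM (is_derive_cst b t 1) (ds t)))).
  by rewrite /GRing.scale /=; ring.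
have dF (t : R) : is_derive t 1 F (f t).
  have d1 := schwartz_is_derive 1 t su; have d0 := schwartz_is_derive 0 t su.
  have E : F = (fun t => derive1n 1 u t * (al * cos (y * t) + be * sin (y * t))) +
     (fun t => y * u t) * (fun t => - be * cos (y * t) + al * sin (y * t)).
    by apply/funext => s; rewrite /F /= !fctE; ring.
  rewrite E.
  have dy : is_derive t 1 (fun t => y * u t) (y * derive1n 1 u t).
    apply: (is_derive_eq (is_deriveM (is_derive_cst y t 1) d0)).
    by rewrite /GRing.scale /=; ring.
  apply: (is_derive_eq (is_deriveD (is_deriveM d1 (dlin al be t))
    (is_deriveM dy (dlin (- be) al t)))).
  by rewrite /GRing.scale /f /=; ring.
have lb (a b t : R) : `|a * cos (y * t) + b * sin (y * t)| <= `|a| + `|b|.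
  apply: le_trans (ler_normD _ _) _; rewrite !normrM.
  by apply: lerD; rewrite ler_piMr ?cos_le1n ?sin_le1n.
have ml (a b : R) : continuous (fun t => a * cos (y * t) + b * sin (y * t)).
  exact: (is_derive_cont (dlin a b)).
have i2 := intgD (schwartz_intg 2 su) (intgZ (y ^+ 2) (schwartz_intg 0 su)).
have fi : intg f := intgM i2 (cont_meas (ml al be)) (lb al be).
split; first exact: fi.
have cf : continuous f.
  move=> t; apply: cvgM; last exact: ml.
  apply: cvgD; first exact: schwartz_cont.
  by apply: cvgM; [exact: cvg_cst|exact: schwartz_cont0].
have L (s : R) : `|s| = 1 -> F (s * k.+1%:R) @[k --> \oo] --> (0 : R).
  move=> s1; pose D k := (`|al| + `|be|) * `|derive1n 1 u (s * k.+1%:R)| +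
     `|y| * (`|al| + `|be|) * `|u (s * k.+1%:R)|.
  have cD : D k @[k --> \oo] --> (0 : R).
    rewrite (_ : 0 = (`|al| + `|be|) * `|0 : R| + `|y| * (`|al| + `|be|) * `|0 : R|); last first.
      by rewrite normr0 !mulr0 addr0.
    apply: cvgD; apply: cvgM; (try exact: cvg_cst); apply: cvg_norm.
      exact: schwartz_cvg0.
    exact: (schwartz_cvg0 su s1 0).
  apply/norm_cvg0P; apply: (squeeze_cvgr _ (@cvg_cst _ 0 _ _ _) cD).
  apply: nearW => k; rewrite normr_ge0 /=; apply: le_trans (ler_normD _ _) _.
  rewrite !normrM; apply: lerD.
    by rewrite mulrC; apply: ler_wpM2r => //; exact: lb.
  rewrite -!mulrA; apply: ler_wpM2l => //; rewrite mulrC; apply: ler_wpM2r => //.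
  have := lb (- be) al (s * k.+1%:R).
  by rewrite normrN mulNr [X in `|X| <= _]addrC [X in _ <= X]addrC.
rewrite (@I_FTC _ f f f F F 0 0) //; first by ring.
  by have := L 1; rewrite normr1 => /(_ erefl); under eq_fun do rewrite mul1r.
by have := L (-1); rewrite normrN normr1 => /(_ erefl); under eq_fun do rewrite mulN1r.
Qed.

(** The integral common to [fourier], with the sign of the frequency reversed, and [ifourier], up to
    the factor [c0]. *)
Definition trig_transform (g : R -> C) (y : R) : C := cint (fun t => eix (y * t) * g t).

Lemma fourierE (g : R -> C) x : fourier g x = trig_transform g (- x).
Proof. by apply: cint_ext => t; rewrite mulrC mulNr (mulrC t). Qed.

Lemma schwartz_cig (phi : R -> C) : schwartz phi -> cintegrable phi.
Proof. by move=> [pr pi]; split; [exact: (schwartz_intg 0 pr)|exact: (schwartz_intg 0 pi)]. Qed.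

Lemma schwartz_ccont (phi : R -> C) : schwartz phi -> ccontinuous phi.
Proof. by move=> [pr pi]; split; [exact: (schwartz_cont0 pr)|exact: (schwartz_cont0 pi)]. Qed.

Lemma schwartz_transform_decay (phi : R -> C) : schwartz phi -> exists K : R, forall y,
  abs1 (trig_transform phi y) <= K * (1 + y ^+ 2)^-1.
Proof.
move=> sp; have ip := schwartz_cig sp.
pose phi2 t : C := derive1n 2 (reF phi) t +i* derive1n 2 (imF phi) t.
have i2 : cintegrable phi2.
  by case: sp => pr pi; split; [exact: (schwartz_intg 2 pr)|exact: (schwartz_intg 2 pi)].
pose chi t := phi t - phi2 t.
have ic : cintegrable chi := cigB ip i2.
exists (2 * norm1 chi) => y; rewrite ler_pdivlMr ?oneD_sqr_gt0//.
have E : trig_transform chi y = (1 + y ^+ 2)%:C * trig_transform phi y.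
  have e0 := cig_eix y ip; have e2 := cig_eix y i2.
  have Z : cint (fun t => eix (y * t) * phi2 t + (y ^+ 2)%:C * (eix (y * t) * phi t)) = 0.
    case: sp => pr pi.
    (* The real part of e^(iyt) phi is cos Re phi - sin Im phi, the imaginary part sin Re phi + cos
       Im phi; the coefficients (al, be) select these four pieces. *)
    have [a1 a2] := schwartz_by_parts y 1 0 pr; have [b1 b2] := schwartz_by_parts y 0 (-1) pi.
    have [c1 c2] := schwartz_by_parts y 0 1 pr; have [d1 d2] := schwartz_by_parts y 1 0 pi.
    apply/eqP; rewrite eq_complex; apply/andP; split; apply/eqP; rewrite /cint [LHS]/= [RHS]/=.
      have P := congr2 +%R a2 b2; rewrite addr0 -ID// in P.
      rewrite -[RHS]P; apply: I_ext => t.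
      transitivity (complex.Re (eix (y * t) * phi2 t + (y ^+ 2)%:C * (eix (y * t) * phi t))); first by [].
      rewrite /phi2; move: (derive1n 2 (reF phi) t) (derive1n 2 (imF phi) t) => A B.
      rewrite /reF /imF /eix; move: (cos (y * t)) (sin (y * t)) (y ^+ 2) => cc ss Y.
      by case: (phi t) => p1 p2 /=; ring.
    have P := congr2 +%R c2 d2; rewrite addr0 -ID// in P.
    rewrite -[RHS]P; apply: I_ext => t.
    transitivity (complex.Im (eix (y * t) * phi2 t + (y ^+ 2)%:C * (eix (y * t) * phi t))); first by [].
    rewrite /phi2; move: (derive1n 2 (reF phi) t) (derive1n 2 (imF phi) t) => A B.
    rewrite /reF /imF /eix; move: (cos (y * t)) (sin (y * t)) (y ^+ 2) => cc ss Y.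
    by case: (phi t) => p1 p2 /=; ring.
  rewrite cintD in Z; [|exact: e2|exact: cigZ].
  rewrite cintZ// in Z.
  rewrite /trig_transform.
  have -> : cint (fun t => eix (y * t) * chi t) =
      cint (fun t => eix (y * t) * phi t) + -1 * cint (fun t => eix (y * t) * phi2 t).
    rewrite -cintZ// -cintD//; last exact: cigZ.
    by apply: cint_ext => t; rewrite /chi; ring.
  rewrite rmorphD /= mulrDl; have -> : 1%:C = 1 :> C by [].
  by rewrite mul1r; congr (_ + _); rewrite mulN1r; apply/eqP; rewrite eqr_oppLR -addr_eq0 Z.
have : abs1 (trig_transform chi y) <= 2 * norm1 chi.
  apply: le_trans (abs1_cint (cig_eix y ic)) _.
  have := norm1Mb ic (cmeas_eix y) (fun t => abs1_eix (y * t)).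
  by apply: le_trans; rewrite le_eqVlt; apply/orP; left; apply/eqP; apply: I_ext => t; rewrite mulrC.
rewrite E; apply: le_trans.
case: (trig_transform phi y) => a b; rewrite /abs1 /= !mul0r subr0 addr0 !normrM.
by rewrite (ger0_norm (ltW (oneD_sqr_gt0 y))) mulrDl; apply: lerD; rewrite mulrC.
Qed.

Lemma schwartz_fourier_cig (phi : R -> C) : schwartz phi -> cintegrable (fourier phi).
Proof.
move=> sp; have [K hK] := schwartz_transform_decay sp.
apply: (@cig_le _ _ (fun x => K * (1 + x ^+ 2)^-1)); last exact/intgZ/intg_oneDsqrV.
  have c0n : (2 * pi)^-1 != 0 :> R by rewrite invr_eq0 (lt0r_neq0 (mulr_gt0 _ (@pi_gt0 R))).
  (* Measurability is inherited from the continuity of [ifourier], of which the transform is a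
     reflected multiple. *)
  have E : fourier phi = fun x => (2 * pi)%:C * ifourier phi (- x).
    apply/funext => x; rewrite fourierE /ifourier mulrA -rmorphM /=.
    by rewrite divff ?mul1r// -invr_eq0.
  rewrite E; have [cr ci] := ifourier_continuous (schwartz_cig sp).
  apply: (cmeasM (cmeas_cst _)); split.
    by apply: (measurableT_comp (cont_meas cr)); exact: oppr_measurable.
  by apply: (measurableT_comp (cont_meas ci)); exact: oppr_measurable.
by move=> x; rewrite fourierE; apply: le_trans (hK _) _; rewrite sqrrN.
Qed.

(** The multiplication formula moves the inverse transform from psi onto [fourier phi], and
    inversion returns phi; it holds at every point because Schwartz functions are continuous. *)
Lemma ifourier_tempered (psi : R -> C) : cintegrable psi ->
  tempered_fourier_eq (ifourier psi) psi.
Proof.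
move=> ip phi sp; have ih := schwartz_fourier_cig sp.
have [_ inv] := fourier_inversion (schwartz_cig sp) ih.
have ic := cigZ ((2 * pi)^-1)%:C ip.
have mk : cmeas2 (fun z : measurableTypeR R * measurableTypeR R => eix (z.1 * z.2)).
  by apply: cmeas2_eix; apply: measurable_funM; [exact: measurable_fst|exact: measurable_snd].
have := cint_swap ih ic mk (fun z => abs1_eix _); rewrite /= => E.
transitivity (cint (fun x => fourier phi x * cint (fun y => ((2 * pi)^-1)%:C * psi y * eix (x * y)))).
  apply: cint_ext => x; rewrite mulrC; congr (_ * _).
  rewrite /ifourier -cintZ; last exact: cig_eix.
  by apply: cint_ext => t; rewrite -mulrA (mulrC (psi t)).
rewrite E; apply: cint_ext => t; rewrite (inv (schwartz_ccont sp) t) /ifourier.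
have -> : cint (fun x => eix (t * x) * fourier phi x) = cint (fun x => fourier phi x * eix (x * t)).
  by apply: cint_ext => x; rewrite mulrC (mulrC t).
by rewrite [RHS]mulrCA mulrA.
Qed.

End Schwartz.

(** * The cut-off multiplier *)

Section CutoffMultiplier.
Context {R : realType} (lam : R) (b : R -> R).
Context (lam0 : 0 < lam).
Context (sb : smooth b).
Context (b01 : forall xi : R, 0 <= b xi <= 1).
Context (b0 : forall xi : R, Num.sqrt 2 * lam <= `|xi| -> b xi = 0).

Definition cutoff_mult (xi : R) : R := b xi / (4 * lam ^+ 2 - xi ^+ 2).

Let l2 : 0 < lam ^+ 2. Proof. by rewrite exprn_gt0. Qed.

Lemma cutoff_supp xi : b xi != 0 -> xi ^+ 2 <= 2 * lam ^+ 2.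
Proof.
move=> bx; have [h|h] := leP (Num.sqrt 2 * lam) `|xi|; first by rewrite b0 ?eqxx in bx.
rewrite -real_normK ?num_real// -[2]sqr_sqrtr// -exprMn.
by apply: lerXn2r; rewrite ?nnegrE ?mulr_ge0 ?sqrtr_ge0 ?(ltW lam0) ?(ltW h).
Qed.

(* The multiplier is a product of continuous functions once the denominator is truncated
   away from its zeros, which lie outside the support of b. *)
Lemma cutoff_multE xi : cutoff_mult xi = b xi * (Num.max (4 * lam ^+ 2 - xi ^+ 2) (2 * lam ^+ 2))^-1.
Proof.
rewrite /cutoff_mult; have [->|bx] := eqVneq (b xi) 0; first by rewrite !mul0r.
congr (_ / _); apply/esym/max_idPl; have := cutoff_supp bx; lra.
Qed.

Let dpos xi : 2 * lam ^+ 2 <= Num.max (4 * lam ^+ 2 - xi ^+ 2) (2 * lam ^+ 2).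
Proof. by rewrite le_max lexx orbT. Qed.

Lemma cutoff_mult_meas : measurable_fun setT cutoff_mult.
Proof.
rewrite (_ : cutoff_mult = fun xi => b xi * (Num.max (4 * lam ^+ 2 - xi ^+ 2) (2 * lam ^+ 2))^-1);
  last by apply/funext => xi; exact: cutoff_multE.
apply: cont_meas => xi; apply: cvgM.
  have sb' : forall (n : nat) (x : R), derivable (derive1n n b) x 1 := sb.
  by apply: derivable_continuous; have := sb' 0%N xi.
apply: cvgV; first by rewrite gt_eqF// (lt_le_trans _ (dpos xi))// mulr_gt0.
apply: (continuous_max (f := fun xi : R => 4 * lam ^+ 2 - xi ^+ 2)); last exact: cvg_cst.
apply: cvgB; first exact: cvg_cst.
exact: exprn_continuous.
Qed.

Lemma cutoff_mult_le xi : `|cutoff_mult xi| <= (2 * lam ^+ 2)^-1.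
Proof.
have d0 : 0 < 2 * lam ^+ 2 by rewrite mulr_gt0.
rewrite cutoff_multE normrM; have /andP[p0 p1] := b01 xi.
rewrite (ger0_norm p0) ger0_norm ?invr_ge0; last exact: le_trans (ltW d0) (dpos xi).
rewrite -[leRHS]mul1r; apply: ler_pM => //.
  by rewrite invr_ge0; exact: le_trans (ltW d0) (dpos xi).
by rewrite lef_pV2 ?posrE//; exact: lt_le_trans d0 (dpos xi).
Qed.

Lemma cutoff_multX_le xi : `|xi * cutoff_mult xi| <= lam^-1.
Proof.
have [bx|bx] := eqVneq (b xi) 0.
  by rewrite /cutoff_mult bx mul0r mulr0 normr0 invr_ge0 ltW.
(* The support lies in |xi| <= sqrt 2 lam; the rounder bound 2 lam, times 1/(2 lam^2), gives
   1/lam. *)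
have h : `|xi| <= 2 * lam.
  rewrite -(@ler_pXn2r _ 2) ?nnegrE ?mulr_ge0 ?(ltW lam0)// real_normK ?num_real//.
  apply: le_trans (cutoff_supp bx) _; rewrite exprMn; have := l2; lra.
rewrite normrM; apply: le_trans (ler_pM _ _ h (cutoff_mult_le xi)) _ => //.
by rewrite le_eqVlt; apply/orP; left; apply/eqP; field; rewrite gt_eqF.
Qed.

End CutoffMultiplier.

Lemma ifourier_cvg0 (R : realType) (g : R -> R[i]) : cintegrable g ->
  (fun x => cabs (ifourier g x)) x @[x --> +oo] --> 0 /\
  (fun x => cabs (ifourier g x)) x @[x --> -oo] --> 0.
Proof.
move=> ig; have V := fourier_vanish ig.
split; apply/cvgrPdist_le => e e0; have [X hX] := V e e0; near=> x;
  rewrite sub0r normrN ger0_norm ?sqrtr_ge0//; apply: le_trans (cabs_le_abs1 _) _; apply: hX.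
  apply: le_trans (ler_norm x).
  by near: x; apply: nbhs_pinfty_ge; exact: num_real.
rewrite -normrN; apply: le_trans (ler_norm (- x)).
by rewrite lerNr; near: x; apply: nbhs_ninfty_le; exact: num_real.
Unshelve. all: end_near. Qed.

Theorem theorem6p2 (R : realType) (lam : R) (b : R -> R) (p : R -> R[i]) :
  0 < lam ->
  smooth b ->
  (forall xi : R, 0 <= b xi <= 1) ->
  (forall xi : R, `|xi| <= lam -> b xi = 1) ->
  (forall xi : R, Num.sqrt 2 * lam <= `|xi| -> b xi = 0) ->
  cintegrable p ->
  cintegrable (fourier p) ->
  L1norm (fourier p) < lam ^+ 2 / 18 ->
  exists psi : R -> R[i],
    cintegrable psi /\
    let sigma := ifourier psi in
    ccontinuous sigma /\
    (fun x => cabs (sigma x)) x @[x --> +oo] --> 0 /\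
    (fun x => cabs (sigma x)) x @[x --> -oo] --> 0 /\
    tempered_fourier_eq sigma psi /\
    {ae @lebesgue_measure R, forall x : R, sigma x = Sop lam (Tb lam b psi) x + p x} /\
    (ccontinuous p -> forall x : R, sigma x = Sop lam (Tb lam b psi) x + p x).
Proof.
move=> lam0 sb b01 _ b0 ip ih hp.
(* Passing to [norm1] costs a factor 2 and (2 pi)^-1 <= 1/4 more than recovers it: lam^2/18 becomes
   lam^2/36. *)
have nh : wnorm (fourier p) <= lam ^+ 2 / 36.
  have h1 := norm1_cabs ih.
  apply: le_trans (ler_pM (@c0_ge0 R) (norm1_ge0 _) (@c0_le R) h1) _; lra.
have [psi [ipsi E]] := wiener_fixpoint lam0 (cutoff_mult_meas lam0 sb b0)
  (cutoff_mult_le lam0 b01 b0) (cutoff_multX_le lam0 b01 b0) ih nh.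
have [ae_inv inv] := fourier_inversion ip ih.
have [v1 v2] := ifourier_cvg0 ipsi.
exists psi; split => //; split; first exact: ifourier_continuous.
split => //; split => //; split; first exact: ifourier_tempered.
split; last by move=> pc x; rewrite E -inv.
by apply: ae_imp ae_inv _ => x ->; exact: E.
Qed.
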